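(* Suppose $\mathfrak p=(p_d)_{d\ge1}$ and $\mathfrak q=(q_d)_{d\ge1}$, with $p_d,q_d\in\mathcal P_d(\mathbb R)$, are two sequences of polynomials with infinitesimal distributions $(\mu,\mu')$ and $(\nu,\nu')$, respectively, where $\nu$ is supported on $[0,\infty)$. Then, for every $n\ge1$, the finite-free cumulants of $p_d\boxtimes_d q_d$ satisfy, as $d\to\infty$ (with $d\ge n$), $$\kappa_n(p_d\boxtimes_d q_d)=r_n(\mu\boxtimes\nu)+\frac1d\,\widehat r_n(\mathfrak p\boxtimes\mathfrak q)+o(1/d),$$ where $$\widehat r_n(\mathfrak p\boxtimes\mathfrak q)=\sum_{\pi\in NC(n)}\Bigl(\sum_{V\in\pi}\widehat r_{|V|}(\mathfrak p)\,r_{\pi\setminus V}(\mu)\cdot r_{Kr(\pi)}(\nu)+\sum_{W\in Kr(\pi)}r_\pi(\mu)\cdot\widehat r_{|W|}(\mathfrak q)\,r_{Kr(\pi)\setminus W}(\nu)\Bigr)-\frac n2\sum_{\substack{t+s=n\\ \sigma\in S_{NC}(t,s)}}\frac{r_\sigma(\mu)\,r_{Kr_{t,s}(\sigma)}(\nu)}{ts}.$$ Consequently, the finite-free multiplicative convolution $\mathfrak p\boxtimes\mathfrak q=(p_d\boxtimes_d q_d)_{d\ge1}$ has infinitesimal moments given by $$m_n'(\mathfrak p\boxtimes\mathfrak q)=\sum_{\pi\in NC(n)}\sum_{V\in\pi}\widehat r_{|V|}(\mathfrak p\boxtimes\mathfrak q)\cdot r_{\pi\setminus V}(\mu\boxtimes\nu)\;-\;\frac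 n2\sum_{\substack{s+t=n\\ \sigma\in S_{NC}(s,t)}}\frac{r_\sigma(\mu\boxtimes\nu)}{st}\qquad\text{for every } n\ge1.$$
   Context: $\mathcal P_d(\mathbb R)$ is the set of monic real polynomials of degree $d$ with only real roots. For a monic real polynomial $p_d$ of degree $d$ with (complex) roots $\lambda_1,\dots,\lambda_d$ with multiplicity, $m_n(p_d)=\frac1d\sum_k\lambda_k^n$. Write $p_d(x)=\sum_{k=0}^d x^{d-k}(-1)^k\binom dk\mathsf e_k(p_d)$. The finite-free multiplicative convolution is $$[p_d\boxtimes_d q_d](x)=\sum_{k=0}^d x^{d-k}(-1)^k\binom dk\,\mathsf e_k(p_d)\,\mathsf e_k(q_d)$$ (real-rooted when, in addition, one of the factors has no negative roots). The finite-free cumulants are $\kappa_n(p_d)=\frac{(-d)^{n-1}}{(n-1)!}\sum_{\pi\in P(n)}(-1)^{|\pi|-1}(|\pi|-1)!\prod_{V\in\pi}\mathsf e_{|V|}(p_d)$, $1\le n\le d$, with $P(n)$ the set of partitions of $[n]=\{1,\dots,n\}$ and $|\pi|$ the number of blocks. A sequence $\mathfrak p$ has infinitesimal distribution $(\mu,\mu')$ if $\mu$ is a probability distribution on $\mathbb R$ with finite moments $m_n(\mu)$ of all orders, $m_n(p_d)\to m_n(\mu)$ for all $n\ge0$, the infinitesimal moments $m_n'(\mathfrak p)=\lim_{d\to\infty}d\,(m_n(p_d)-m_n(\mu))$ exist for all $n\ge1$, and $\mu':\mathbb R[x]\to\mathbb R$ is the linear functional with $\mu'(1)=0$, $\mu'(x^n)=m_n'(\mathfrak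 p)$. The infinitesimal moments of $\mathfrak p\boxtimes\mathfrak q$ are $m_n'(\mathfrak p\boxtimes\mathfrak q)=\lim_{d\to\infty}d\,(m_n(p_d\boxtimes_d q_d)-m_n(\mu\boxtimes\nu))$. The cumulant fluctuations of a sequence $\mathfrak p$ with infinitesimal distribution $(\mu,\mu')$ are the numbers $\widehat r_n(\mathfrak p)$ with $\kappa_n(p_d)=r_n(\mu)+\frac1d\widehat r_n(\mathfrak p)+o(1/d)$ as $d\to\infty$ (they always exist). $NC(n)$ is the set of non-crossing partitions of $[n]$. For a sequence $(u_n)$: $u_\pi=\prod_{V\in\pi}u_{|V|}$, $u_{\pi\setminus V}=\prod_{W\in\pi,W\neq V}u_{|W|}$, $u_\sigma=\prod_c u_{|c|}$ over cycles $c$ (fixed points included) of a permutation $\sigma$. For $\pi\in NC(n)$, $Kr(\pi)\in NC(n)$ is the Kreweras complement: viewing $\pi$ as the permutation whose cycles are its blocks in increasing order and $\gamma_n=(1,2,\dots,n)$, $Kr(\pi)$ is the partition whose blocks are the cycles of $\pi^{-1}\gamma_n$. Free cumulants $r_n(\mu)$ are defined recursively by $m_n(\mu)=\sum_{\pi\in NC(n)}r_\pi(\mu)$. Throughout, only distributions determined by their moments are considered; for $\nu$ supported on $[0,\infty)$, the free multiplicative convolution $\mu\boxtimes\nu$ is the probability measure with $r_n(\mu\boxtimes\nu)=\sum_{\pi\in NC(n)}r_\pi(\mu)\,r_{Kr(\pi)}(\nu)$ for all $n\ge1$. For $t,s\ge1$ let $\gamma_{t,s}=(1,\dots,t)(t+1,\dots,t+s)\in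 S_{t+s}$; $S_{NC}(t,s)$ is the set of $\sigma\in S_{t+s}$ such that $\langle\sigma,\gamma_{t,s}\rangle$ acts transitively on $[t+s]$ and $|\sigma|+|\sigma^{-1}\gamma_{t,s}|=t+s$, $|\cdot|$ counting cycles including fixed points; $Kr_{t,s}(\sigma)=\sigma^{-1}\gamma_{t,s}$. Sums over $t+s=n$ run over ordered pairs of integers $t,s\ge1$. *)

(* Defs.v *)
From HB Require Import structures.
From mathcomp Require Import all_boot all_order all_algebra all_fingroup.
From mathcomp Require Import complex.
From mathcomp Require Import all_classical all_reals all_analysis.

Set Implicit Arguments.
Unset Strict Implicit.
Unset Printing Implicit Defensive.

Import Order.TTheory GRing.Theory Num.Theory.
Import numFieldNormedType.Exports.

Local Open Scope ring_scope.

(* [n] = {1, ..., n} is rendered as 'I_n = {0, ..., n-1} throughout. *)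

Section Combinatorics.

Definition set_partitions (n : nat) : {set {set {set 'I_n}}} :=
  [set P | finset.partition P [set: 'I_n]]%SET.

Definition noncrossing (n : nat) (P : {set {set 'I_n}}) : bool :=
  [forall V in P, forall W in P, (V != W) ==>
    [forall a in V, forall b in W, forall c in V, forall d in W,
      ~~ [&& (a < b)%N, (b < c)%N & (c < d)%N]]].

Definition NC (n : nat) : {set {set {set 'I_n}}} :=
  [set P in set_partitions n | noncrossing P]%SET.

(* As [enum V] is increasing, [next (enum V)] cycles through the block V in
   increasing order.  The default value 1 of [insubd] is only reached when P is
   not a partition, cf. [partition_permE]. *)
Definition partition_perm (n : nat) (P : {set {set 'I_n}}) : 'S_n :=
  insubd (1%g : {perm 'I_n}) [ffun i => next (enum (finset.pblock P i)) i].

Definition gamma (n : nat) : 'S_n := perm (@ordS_inj n).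

Definition gamma2_fun (t s : nat) (i : 'I_(t + s)) : 'I_(t + s) :=
  match fintype.split i with
  | inl j => lshift s (ordS j)
  | inr k => rshift t (ordS k)
  end.

Lemma gamma2_fun_inj (t s : nat) : injective (@gamma2_fun t s).
Proof.
move=> i j; rewrite /gamma2_fun.
case: (split_ordP i) => i' ->; case: (split_ordP j) => j' ->.
- by move=> /lshift_inj /ordS_inj ->.
- by move=> /eqP; rewrite eq_lrshift.
- by move=> /eqP; rewrite eq_rlshift.
- by move=> /rshift_inj /ordS_inj ->.
Qed.

Definition gamma2 (t s : nat) : 'S_(t + s) := perm (@gamma2_fun_inj t s).

(* In MathComp (s * t) x = t (s x), so that the composite written
   sigma^{-1} gamma (first gamma, then sigma^{-1}) is gamma * sigma^-1. *)
Definition Kr (n : nat) (P : {set {set 'I_n}}) : {set {set 'I_n}} :=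
  porbits (gamma n * (partition_perm P)^-1)%g.

Definition Kr2 (t s : nat) (sigma : 'S_(t + s)) : 'S_(t + s) :=
  (gamma2 t s * sigma^-1)%g.

Definition SNC (t s : nat) : {set 'S_(t + s)} :=
  [set sigma : 'S_(t + s) |
    [transitive <<[set sigma; gamma2 t s]>>, on [set: 'I_(t + s)] | 'P]%act
    && (#|porbits sigma| + #|porbits (Kr2 sigma)| == t + s)%N]%SET.

Lemma partition_permE (n : nat) (P : {set {set 'I_n}}) (i : 'I_n) :
  finset.partition P [set: 'I_n]%SET ->
  partition_perm P i = next (enum (finset.pblock P i)) i.
Proof.
move=> partP.
have [/eqP covP /andP[tiP _]] := andP partP.
have inP (j : 'I_n) : j \in finset.cover P by rewrite covP inE.
have nextP (j : 'I_n) : next (enum (finset.pblock P j)) j \in finset.pblock P j.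
  by have := mem_next (enum (finset.pblock P j)) j; rewrite !mem_enum mem_pblock inP.
have inj : injectiveb [ffun j => next (enum (finset.pblock P j)) j].
  apply/injectiveP => j k; rewrite !ffunE => E.
  have Ejk : finset.pblock P j = finset.pblock P k.
    rewrite -(same_pblock tiP (nextP j)) E; exact: same_pblock tiP (nextP k).
  move: E; rewrite Ejk => /(congr1 (prev (enum (finset.pblock P k)))).
  by rewrite !prev_next ?enum_uniq.
by rewrite -pvalE -[pval _]/(val _) val_insubd inj ffunE.
Qed.

End Combinatorics.

Section BlockProducts.
Variable R : realType.

(* u_P for a partition P, u_(P minus V) when applied to P :\ V, and u_sigma for a
   permutation sigma when applied to porbits sigma. *)
Definition blockprod (T : finType) (u : nat -> R) (P : {set {set T}}) : R :=
  \prod_(V in P) u #|V|.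

(* sum over V in P of v_|V| u_(P minus V) *)
Definition blockderiv (T : finType) (v u : nat -> R) (P : {set {set T}}) : R :=
  \sum_(V in P) v #|V| * blockprod u (P :\ V)%SET.

End BlockProducts.

Section FiniteFree.
Variable R : realType.

Definition monic_real_rooted (d : nat) (p : {poly R}) : Prop :=
  [/\ p \is monic, size p = d.+1 &
      forall z : R[i], root (map_poly (real_complex R) p) z -> z \is Num.real].

Definition complex_roots (p : {poly R}) : seq R[i] :=
  sval (closed_field_poly_normal (map_poly (real_complex R) p)).

Lemma complex_rootsE (p : {poly R}) : p \is monic ->
  map_poly (real_complex R) p = \prod_(z <- complex_roots p) ('X - z%:P).
Proof.
move=> mp; rewrite /complex_roots; case: closed_field_poly_normal => r /= {1}->.
by rewrite lead_coef_map (monicP mp) rmorph1 scale1r.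
Qed.

(* The mean of the n-th powers of the complex roots is a real number, cf.
   [poly_momentE]; Re only serves to view it in R. *)
Definition poly_moment (d : nat) (p : {poly R}) (n : nat) : R :=
  complex.Re (d%:R^-1 * \sum_(z <- complex_roots p) z ^+ n).

Lemma poly_momentE (d : nat) (p : {poly R}) (n : nat) : p \is monic ->
  real_complex R (poly_moment d p n) =
    d%:R^-1 * \sum_(z <- complex_roots p) z ^+ n.
Proof.
move=> mp; have pE := complex_rootsE mp.
have perm_conj : perm_eq [seq Num.conj z | z <- complex_roots p] (complex_roots p).
  apply: prod_XsubC_eq; rewrite -pE big_map.
  transitivity (map_poly Num.conj (\prod_(z <- complex_roots p) ('X - z%:P))).
    rewrite rmorph_prod; apply: eq_bigr => z _.
    by rewrite /= rmorphB /= map_polyX map_polyC.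
  rewrite -pE -map_poly_comp; apply: eq_map_poly => x /=.
  by rewrite conj_Creal // complex_real.
rewrite /poly_moment; set w := _ * _.
have : w \is Num.real.
  rewrite CrealE /w rmorphM fmorphV rmorph_nat rmorph_sum /=; apply/eqP; congr (_ * _).
  rewrite -[RHS](perm_big _ perm_conj) big_map.
  by apply: eq_bigr => z _; rewrite rmorphXn.
by move=> /RRe_real.
Qed.

(* p = \sum_k (-1)^k 'C(d, k) e_k(p) X^(d - k) *)
Definition ecoef (d : nat) (p : {poly R}) (k : nat) : R :=
  (-1) ^+ k * p`_(d - k) / 'C(d, k)%:R.

Lemma ecoefE (d : nat) (p : {poly R}) : size p = d.+1 ->
  p = \sum_(k < d.+1) ((-1) ^+ k * 'C(d, k)%:R * ecoef d p k) *: 'X^(d - k).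
Proof.
move=> sp; rewrite -[LHS]coefK sp poly_def (reindex_inj rev_ord_inj) /=.
apply: eq_bigr => k _; rewrite subSS; congr (_ *: _).
have kd : (k <= d)%N by rewrite -ltnS.
have C0 : 'C(d, k)%:R != 0 :> R by rewrite pnatr_eq0 -lt0n bin_gt0.
rewrite /ecoef -[RHS]mulrA [_ * (_ / _)]mulrC divfK // mulrA -exprD addnn.
by rewrite -mul2n exprM sqrrN !expr1n mul1r.
Qed.

Definition mul_conv (d : nat) (p q : {poly R}) : {poly R} :=
  \sum_(k < d.+1)
    ((-1) ^+ k * 'C(d, k)%:R * ecoef d p k * ecoef d q k) *: 'X^(d - k).

Definition seq_mul_conv (p q : nat -> {poly R}) : nat -> {poly R} :=
  fun d => mul_conv d (p d) (q d).

Definition finite_free_cumulant (d : nat) (p : {poly R}) (n : nat) : R :=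
  (- d%:R) ^+ n.-1 / (n.-1)`!%:R *
  \sum_(P in set_partitions n)
    (-1) ^+ #|P|.-1 * (#|P|.-1)`!%:R * blockprod (ecoef d p) P.

End FiniteFree.

Section FreeProbability.
Variable R : realType.
Implicit Types mu nu rho : probability (measurableTypeR R) R.

Definition finite_moments mu : Prop :=
  forall n : nat, mu.-integrable [set: measurableTypeR R]%classic
    (fun x : measurableTypeR R => (x ^+ n)%:E).

Definition dist_moment mu (n : nat) : R :=
  (\int[mu]_(x in [set: measurableTypeR R]%classic) (x ^+ n))%R.

Definition moment_determined mu : Prop :=
  forall rho, finite_moments rho ->
    (forall n, dist_moment rho n = dist_moment mu n) ->
    forall A, measurable A -> rho A = mu A.

Definition supported_on_nonneg mu : Prop := mu `]-oo, 0[%classic = 0%E.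

(* In m_n = \sum_(P in NC n) r_P the one-block partition contributes r_n and the
   blocks of all others have size < n; the first argument is recursion fuel. *)
Fixpoint free_cumulant_rec (N : nat) (m : nat -> R) (n : nat) : R :=
  if N is N'.+1 then
    m n - \sum_(P in NC n | P != [set [set: 'I_n]]%SET)
            blockprod (free_cumulant_rec N' m) P
  else 0.

Definition free_cumulant mu (n : nat) : R :=
  free_cumulant_rec n (dist_moment mu) n.

Lemma NC_block_size (n : nat) (P : {set {set 'I_n}}) (V : {set 'I_n}) :
  P \in NC n -> P != [set [set: 'I_n]]%SET -> V \in P -> (1 <= #|V| < n)%N.
Proof.
rewrite !inE => /andP[partP _] nP VP; rewrite card_gt0 (partition_neq0 partP VP).
have /and3P[_ tiP P0] := partP.
rewrite /= ltn_neqAle -[X in (_ <= X)%N]card_ord max_card andbT.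
apply: contra nP => /eqP cV.
have VT : V = [set: 'I_n]%SET by apply/eqP; rewrite eqEcard finset.subsetT cardsT card_ord cV leqnn.
apply/eqP/setP => W; rewrite inE -VT; apply/idP/eqP => [WP|->//].
apply/eqP; apply: contraT => WV.
have /finset.trivIsetP/(_ _ _ WP VP WV) := tiP.
rewrite -finset.setI_eq0 VT finset.setIT => /eqP W0.
by rewrite -W0 WP in P0.
Qed.

Lemma free_cumulant_rec_stable (m : nat -> R) (N n : nat) : (1 <= n <= N)%N ->
  free_cumulant_rec N m n = free_cumulant_rec n m n.
Proof.
elim/ltn_ind: n N => -[|n] // IH [|N] //= nN; congr (_ - _).
apply: eq_bigr => P /andP[PNC nP]; apply: eq_bigr => V VP.
have /andP[V0 Vn] := NC_block_size PNC nP VP.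
have VN : (#|V| <= N)%N by rewrite -ltnS (leq_trans Vn).
by rewrite (IH _ Vn N) ?V0 // (IH _ Vn n) // V0 -ltnS.
Qed.

Lemma free_cumulantE mu (n : nat) : (1 <= n)%N ->
  dist_moment mu n = \sum_(P in NC n) blockprod (free_cumulant mu) P.
Proof.
case: n => [//|n] _.
rewrite (bigD1 [set [set: 'I_n.+1]]%SET) /=; last first.
  rewrite !inE; apply/andP; split.
    apply/and3P; split; first by rewrite /finset.cover big_set1.
      by apply/finset.trivIsetP => A B /set1P-> /set1P->; rewrite eqxx.
    by rewrite inE eq_sym -card_gt0 cardsT card_ord.
  by do 2![apply/forall_inP => ? /set1P->]; rewrite eqxx.
rewrite [X in _ = _ + X](_ : _ =
    \sum_(P in NC n.+1 | P != [set [set: 'I_n.+1]]%SET)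
      blockprod (free_cumulant_rec n (dist_moment mu)) P); last first.
  apply: eq_bigr => P /andP[PNC nP]; apply: eq_bigr => V VP.
  have /andP[V0 Vn] := NC_block_size PNC nP VP.
  by rewrite [RHS]free_cumulant_rec_stable // V0 -ltnS.
by rewrite [blockprod _ [set _]%SET]big_set1 cardsT card_ord /free_cumulant /= subrK.
Qed.


Definition is_free_mul_conv mu nu rho : Prop :=
  finite_moments rho /\
  forall n : nat, (1 <= n)%N ->
    free_cumulant rho n =
    \sum_(P in NC n)
      blockprod (free_cumulant mu) P * blockprod (free_cumulant nu) (Kr P).

Definition has_infinitesimal_moments (p : nat -> {poly R}) mu
    (m' : nat -> R) : Prop :=
  forall n : nat, (1 <= n)%N ->
    (d%:R * (poly_moment d (p d) n - dist_moment mu n) @[d --> \oo] --> m' n)%classic.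

Definition has_infinitesimal_distribution (p : nat -> {poly R}) mu
    (mu' : {scalar {poly R}}) : Prop :=
  [/\ finite_moments mu,
      forall n : nat,
        (poly_moment d (p d) n @[d --> \oo] --> dist_moment mu n)%classic,
      mu' 1 = 0 &
      has_infinitesimal_moments p mu (fun n => mu' 'X^n)].

(* c = \hat r_n(p):  kappa_n(p_d) = r_n(mu) + c / d + o(1 / d) *)
Definition is_cumulant_fluctuation (p : nat -> {poly R}) mu (n : nat) (c : R)
    : Prop :=
  ((fun d : nat => finite_free_cumulant d (p d) n
                   - (free_cumulant mu n + d%:R^-1 * c) : R^o)
     =o_\oo (fun d : nat => d%:R^-1 : R^o))%classic.

Definition cumulant_fluctuation (p : nat -> {poly R}) mu (n : nat) : R :=
  get [set c | is_cumulant_fluctuation p mu n c]%classic.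

Lemma cumulant_fluctuationE (p : nat -> {poly R}) mu (n : nat) (c : R) :
  is_cumulant_fluctuation p mu n c -> cumulant_fluctuation p mu n = c.
Proof.
have lim_of x : is_cumulant_fluctuation p mu n x ->
    (d%:R * (finite_free_cumulant d (p d) n - free_cumulant mu n)
       @[d --> \oo] --> x)%classic.
  move=> /eqoP o_x; apply/cvgrPdist_le => e e0.
  near=> d.
  have d0 : 0 < d%:R :> R by rewrite ltr0n; near: d; exact: nbhs_infty_gt.
  have : `|finite_free_cumulant d (p d) n - (free_cumulant mu n + d%:R^-1 * x)|
           <= e * `|d%:R^-1 : R|.
    by near: d; exact: o_x e e0.
  rewrite (gtr0_norm (_ : 0 < d%:R^-1)) ?invr_gt0 // ler_pdivlMr // => le_e.
  rewrite distrC (le_trans _ le_e) // -[X in _ <= _ * X](gtr0_norm d0) -normrM.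
  by rewrite opprD addrA mulrBl mulrAC mulVf ?gt_eqF // mul1r [_ * d%:R]mulrC.
move=> cE; rewrite /cumulant_fluctuation.
have getE : is_cumulant_fluctuation p mu n
    (get [set x | is_cumulant_fluctuation p mu n x]%classic).
  exact: (@getI _ [set x | is_cumulant_fluctuation p mu n x]%classic c).
exact: cvg_unique (lim_of _ getE) (lim_of _ cE).
Unshelve. all: by end_near.
Qed.

End FreeProbability.

(* Main.v *)
Require Import Defs.
From mathcomp Require Import all_boot all_order all_algebra all_fingroup.
From mathcomp Require Import reals zify ring.
Import Order.TTheory GRing.Theory Num.Theory.
Set Implicit Arguments.
Unset Strict Implicit.
Unset Printing Implicit Defensive.

(** Write [z = - 1 / d].  The finite free cumulants of a convolution and the moments of a
    polynomial are values of one family of sums over pairs of permutations,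
      [F_n (z; a, b) = 1 / (n-1)! * sum_(s, u) z ^ (n + 1 - |s| - |u|) a_s b_u],
    where [s] and [u] range over the permutations of [n] points that together generate a
    transitive group and [|s|] counts cycles; this is [pair_series].  For [n <= d],
      [kappa_n (p boxtimes q) = F_n (z; kappa (p), kappa (q))]  ([cumulant_mul_conv]),
      [m_n (p) = F_n (z; kappa (p), 1)]                         ([poly_moment_series]).

    The reason is that the alternating sum over set partitions in the definition of
    [kappa_n] is, up to scaling, the classical cumulant of the sequence of normalised
    coefficients [e_k].  By the exponential formula each [e_k (p)] is a sum over
    permutations, with a weight [kappa_l z ^ (l-1)] for every cycle of length [l].  The coefficients of the
    convolution are products, hence sums over pairs of permutations, and passing to
    cumulants retains the transitive pairs ([cumulant_rec_transitive_sum]).  Moments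
    fit in because, up to scaling, Newton's identities express them as the cumulants of
    the coefficients multiplied by falling factorials, and [d^_k / d^k] are the
    normalised coefficients of the polynomial all of whose cumulants are 1.

    A transitive pair satisfies [|s| + |u| + |u s| <= n + 2], with an even defect
    ([genus_inequality], [genus_parity]).  So the terms in [z ^ 0] are the pairs whose
    product is an [n]-cycle; up to conjugation these are the noncrossing partitions
    with their Kreweras complements ([sum_NC]).  The terms in [z ^ 1] are the pairs whose
    product has two cycles, of lengths [t] and [s]; up to conjugation these are the
    elements of [SNC t s], and the size of the conjugacy classes accounts for the
    factor [n / (2 t s)] ([sum_gamma2]).  This expands [F_n] to first order in [1 / d]
    when [a] and [b] have such expansions ([expands_pair_series]).

    It remains to see that the cumulants of [p_d] and [q_d] have first order expansions
    around the free cumulants.  In [m_n = F_n (z; kappa, 1)] the cumulant [kappa_n]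
    enters linearly with a coefficient tending to 1, so this follows by induction on [n]
    ([finite_free_cumulant_expands]).  The expansion of [F_n] then gives the cumulants of
    the convolution, and applied once more with [b = 1] it gives their moments. *)

(** * Cycle counts and the genus inequality *)

(** Cardinals are made opaque first: the arithmetic solver does not treat them as
    atoms. *)
Ltac card_lia :=
  repeat match goal with |- context [@card ?T ?A] => move: (@card T A) => ? end; lia.

Section CycleCounts.
Local Open Scope group_scope.
Variable T : finType.
Implicit Types (s u g a b : {perm T}) (x y : T) (A : {set T}).

Definition stable s A := s @: A \subset A.

Lemma stableP s A : reflect (forall x, x \in A -> s x \in A) (stable s A).
Proof.
apply: (iffP subsetP) => [sA x xA|sA _ /imsetP[x xA ->]]; last exact: sA.
by apply: sA; apply: imset_f.
Qed.

(** A stable set is mapped injectively into itself, hence onto itself. *)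
Lemma stable_mem s A x : stable s A -> (s x \in A) = (x \in A).
Proof.
move=> sA; have sAE : s @: A = A.
  by apply/eqP; rewrite eqEcard [_ \subset _]sA card_imset ?leqnn //; exact: perm_inj.
by rewrite -{1}sAE mem_imset //; apply: (@perm_inj _ s).
Qed.

Lemma stableV s A : stable s A -> stable s^-1 A.
Proof. by move=> sA; apply/stableP => x xA; rewrite -(stable_mem _ sA) permKV. Qed.

Lemma stableM s u A : stable s A -> stable u A -> stable (s * u) A.
Proof.
by move=> /stableP sA /stableP uA; apply/stableP => x xA; rewrite permM uA ?sA.
Qed.

Lemma stable_porbit s A x y : stable s A -> y \in porbit s x -> (y \in A) = (x \in A).
Proof.
move=> sA /porbitP[i ->]; elim: i => [|i IH]; first by rewrite perm1.
by rewrite expgSr permM stable_mem.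
Qed.

Lemma mem_porbit1 s x : s x \in porbit s x.
Proof. by have := mem_porbit s 1 x; rewrite expg1. Qed.

Lemma porbit_perm1 s x : porbit s (s x) = porbit s x.
Proof. by have := porbit_perm s 1 x; rewrite expg1. Qed.

Lemma porbit_stable s x : stable s (porbit s x).
Proof.
by apply/stableP => y; rewrite -!eq_porbit_mem porbit_perm1.
Qed.

Lemma porbits1 : #|porbits (1 : {perm T})| = #|T|.
Proof.
rewrite card_imset // => x y /eqP; rewrite eq_porbit_mem => /porbitP[i ->].
by rewrite expg1n perm1.
Qed.

Lemma porbits_mul_tperm_in s x y : x != y -> x \in porbit s y ->
  #|porbits (tperm x y * s)| = #|porbits s|.+1.
Proof.
move=> xy xs; have := porbits_mul_tperm s x y; rewrite /= xs xy /= addn0 => ->.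
by rewrite addn1.
Qed.

Lemma porbits_mul_tperm_out s x y : x \notin porbit s y ->
  #|porbits (tperm x y * s)|.+1 = #|porbits s|.
Proof.
move=> xs; have := porbits_mul_tperm s x y; rewrite /= xs.
have -> : x != y by apply: contraNneq xs => ->; rewrite porbit_id.
by rewrite !addn2 addn1 => -[].
Qed.

Lemma porbits_mulr_tperm s x y : #|porbits (s * tperm x y)| = #|porbits (tperm x y * s^-1)|.
Proof. by rewrite -porbitsV invMg tpermV. Qed.

Lemma porbits_mulr_tperm_in s x y : x != y -> x \in porbit s y ->
  #|porbits (s * tperm x y)| = #|porbits s|.+1.
Proof.
by move=> xy xs; rewrite porbits_mulr_tperm porbits_mul_tperm_in ?porbitsV ?porbitV.
Qed.

Lemma porbits_mulr_tperm_out s x y : x \notin porbit s y ->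
  #|porbits (s * tperm x y)|.+1 = #|porbits s|.
Proof.
by move=> xs; rewrite porbits_mulr_tperm porbits_mul_tperm_out ?porbitsV ?porbitV.
Qed.

Lemma leq_porbits_mul_tperm s x y : #|porbits (tperm x y * s)| <= #|porbits s|.+1.
Proof. by have := porbits_mul_tperm s x y; case: (x != y) => /=; lia. Qed.

Lemma leq_porbits s : #|porbits s| <= #|T|.
Proof. exact: leq_imset_card. Qed.

Lemma perm_neq1 s : s != 1 -> exists x, s x != x.
Proof.
move=> s1; apply/existsP; apply: contraNT s1; rewrite negb_exists => /forallP s1.
by apply/eqP/permP => x; rewrite perm1; apply/eqP; rewrite -[_ == _]negbK.
Qed.

(** The cycle of [x] is split into the fixed point [s x] and the rest. *)
Lemma porbits_split s x : s x != x -> #|porbits (tperm x (s x) * s)| = #|porbits s|.+1.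
Proof.
by move=> sx; rewrite porbits_mul_tperm_in 1?eq_sym // porbit_sym mem_porbit1.
Qed.

(** Triangle inequality for the Cayley length [#|T| - #|porbits s|]: [s] is a product
    of that many transpositions, and each of them changes the number of cycles of
    a product by at most one. *)
Lemma porbits_triangle s u : #|porbits s| + #|porbits u| <= #|T| + #|porbits (s * u)|.
Proof.
have [m] := ubnP (#|T| - #|porbits s|); elim: m s => // m IH s.
have [->|/perm_neq1[x sx]] := eqVneq s 1.
  by rewrite porbits1 mul1g.
have le_sT := leq_porbits (tperm x (s x) * s); rewrite porbits_split // in le_sT.
move=> ltm; have ltm' : #|T| - #|porbits (tperm x (s x) * s)| < m.
  by rewrite porbits_split //; lia.
have := IH _ ltm'; rewrite porbits_split // -mulgA.
have := leq_porbits_mul_tperm (s * u) x (s x). card_lia.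
Qed.

Lemma porbits1P s : #|porbits s| = 1%N -> forall x y, x \in porbit s y.
Proof.
move=> /eqP/cards1P[C sC] x y; rewrite -eq_porbit_mem.
have in_ z : porbit s z = C by apply/set1P; rewrite -sC imset_f.
by rewrite !in_.
Qed.


(** Spelled so that the transitivity condition of [SNC] is an instance of it. *)
Definition transitive_pair a b := [transitive <<[set a; b]>>, on [set: T] | 'P].

Definition pair_orbit a b x := orbit 'P <<[set a; b]>> x.

Lemma pair_orbit_id a b x : x \in pair_orbit a b x.
Proof. exact: orbit_refl. Qed.

Lemma pair_orbit_stable a b x : stable a (pair_orbit a b x) /\ stable b (pair_orbit a b x).
Proof.
have st s : s \in [set a; b] -> stable s (pair_orbit a b x).
  move=> /(subsetP (subset_gen _)) sG; apply/stableP => y yx.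
  by rewrite -[s y]/('P%act y s) /pair_orbit orbit_actr.
by split; apply: st; rewrite !inE eqxx ?orbT.
Qed.

Lemma pair_orbit_sub a b A x : stable a A -> stable b A -> x \in A ->
  pair_orbit a b x \subset A.
Proof.
move=> aA bA xA; rewrite acts_sub_orbit // gen_subG.
apply/subsetP => s sab; apply/astabsP => y.
by rewrite /= apermE stable_mem //; case/set2P: sab => ->.
Qed.

Lemma transitive_pairE a b x : transitive_pair a b = (pair_orbit a b x == [set: T]).
Proof.
apply/idP/eqP => [ab|cx]; first by rewrite /pair_orbit (atransP ab).
by apply/imsetP; exists x; rewrite // [RHS]cx.
Qed.

(** Through this criterion, transitivity is proved and used by exhibiting stable
    sets, without ever writing down an element of the generated group. *)
Lemma transitive_pairP a b x :
  (forall A, stable a A -> stable b A -> x \in A -> A = [set: T]) <-> transitive_pair a b.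
Proof.
rewrite (transitive_pairE a b x); split=> [H|/eqP cx A aA bA xA].
  have [aC bC] := pair_orbit_stable a b x.
  by apply/eqP; apply: H => //; apply: pair_orbit_id.
by apply/eqP; rewrite eqEsubset subsetT -cx pair_orbit_sub.
Qed.

Lemma transitive_pair_mul x a b : transitive_pair a b = transitive_pair a (b * a).
Proof.
apply/idP/idP => /transitive_pairP H; apply/(transitive_pairP _ _ x) => A aA bA; apply: H => //.
- by have := stableM bA (stableV aA); rewrite mulgK.
- exact: stableM.
Qed.

(** The surface glued from the cycles of [a], [b] and [b * a] has Euler
    characteristic at most 2.  Induction on the number of cycles of [a].  If [a] has
    several cycles, transitivity provides [y] such that [y] and [b y] lie in
    different ones; multiplying [a] by the transposition of [y] and [(b * a) y]
    merges two cycles of [a], splits a cycle of [b * a], and keeps the pair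
    transitive.  When [a] is a single cycle, this is the triangle inequality. *)
Lemma genus_inequality (x0 : T) a b : transitive_pair a b ->
  #|porbits a| + #|porbits b| + #|porbits (b * a)| <= #|T|.+2.
Proof.
have [m] := ubnP #|porbits a|; elim: m a => // m IH a.
rewrite ltnS => am cab.
(* if no [y] works, the cycle of [x0] under [a] is stable under [b] as well *)
case: (pickP (fun y => y \notin porbit a (b y))) => [y yab|ab1]; last first.
  have a1 : #|porbits a| = 1%N.
    apply/eqP/cards1P; exists (porbit a x0).
    have aT : porbit a x0 = [set: T].
      move/transitive_pairP: cab; apply; last exact: porbit_id.
        exact: porbit_stable.
      apply/stableP => y; rewrite -!eq_porbit_mem => /eqP <-.
      by rewrite eq_sym eq_porbit_mem; have /negbFE := ab1 y.
    apply/setP => C; rewrite inE; apply/imsetP/eqP => [[y _ ->]|->]; last by exists x0.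
    by apply/eqP; rewrite eq_porbit_mem aT inE.
  by have := porbits_triangle b^-1 (b * a); rewrite mulKg porbitsV a1; card_lia.
set h := b * a; have hy : h y = a (b y) by rewrite permM.
have y_ha : y \notin porbit a (h y).
  by apply: contra yab; rewrite -!eq_porbit_mem hy porbit_perm1.
have y_h : y \in porbit h (h y) by rewrite porbit_sym mem_porbit1.
have nyh : y != h y by apply: contraNneq y_ha => <-; rewrite porbit_id.
have a'E := porbits_mulr_tperm_out y_ha.
have h'E := porbits_mulr_tperm_in nyh y_h.
have := IH (a * tperm y (h y)); rewrite -a'E in am *.
rewrite mulgA h'E => /(_ am) IH'.
suff /IH' : transitive_pair (a * tperm y (h y)) b by card_lia.
apply/(transitive_pairP _ _ x0) => A a'A bA xA; move/transitive_pairP: cab; apply=> //; last exact: xA.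
(* [y] and [h y] are in one cycle of the new [a], else multiplying back would merge *)
have yhyA : (y \in A) = (h y \in A).
  apply: (stable_porbit a'A); apply: contraT => /porbits_mulr_tperm_out.
  by rewrite -mulgA tperm2 mulg1 -a'E; card_lia.
apply/stableP => z zA.
have : (a * tperm y (h y)) z \in A by rewrite (stable_mem _ a'A).
by rewrite permM; case: tpermP => [->|->|//]; rewrite yhyA.
Qed.

(** Signs are multiplicative; hence the defect in [genus_inequality] is even. *)
Lemma genus_parity a b :
  ~~ odd (#|T| + (#|porbits a| + #|porbits b| + #|porbits (b * a)|)).
Proof.
by have := odd_permM b a; rewrite /odd_perm !oddD; do 4![case: (odd _)].
Qed.
End CycleCounts.

(** * Gluing permutations of complementary sets *)

Local Open Scope ring_scope.

Section Transport.
Variables (U T : finType) (f : U -> T) (a : {perm U}) (s : {perm T}).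
Hypothesis fM : forall u, s (f u) = f (a u).

Lemma porbit_transport u : porbit s (f u) = f @: porbit a u.
Proof.
have fX i : (s ^+ i)%g (f u) = f ((a ^+ i)%g u).
  by elim: i => [|i IH]; rewrite ?expg0 ?perm1 // !expgSr !permM IH fM.
apply/setP => y; apply/porbitP/imsetP => [[i ->]|[_ /porbitP[i ->] ->]].
  by exists ((a ^+ i)%g u); [apply: mem_porbit | rewrite fX].
by exists i; rewrite fX.
Qed.

Lemma blockprod_imset (R : realType) (w : nat -> R) (P : {set {set U}}) :
  injective f -> blockprod w [set f @: (C : {set U}) | C in P] = blockprod w P.
Proof.
move=> fI; rewrite /blockprod big_imset /=; last first.
  by move=> C D _ _; apply: imset_inj.
by apply: eq_bigr => C _; rewrite card_imset.
Qed.

Lemma porbits_transport : (forall y, exists u, y = f u) ->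
  porbits s = [set f @: (C : {set U}) | C in porbits a].
Proof.
move=> fS; apply/setP => C; apply/imsetP/imsetP => [[y _ ->]|[_ /imsetP[u _ ->] ->]].
  have [u ->] := fS y.
  by exists (porbit a u); [apply: imset_f | rewrite porbit_transport].
by exists (f u); rewrite ?porbit_transport.
Qed.

End Transport.

Lemma perm_restrict (U T : finType) (f : U -> T) (s : {perm T}) : injective f ->
  stable s [set f u | u in U] -> exists a : {perm U}, forall u, s (f u) = f (a u).
Proof.
move=> fI /stableP sf.
have ex u : exists u', s (f u) == f u'.
  have /sf/imsetP[u' _ ->] : f u \in [set f u | u in U] by apply: imset_f.
  by exists u'.
pose g u := xchoose (ex u).
have gE u : s (f u) = f (g u) by apply/eqP; apply: (xchooseP (ex u)).
have gI : injective g by move=> u v /(congr1 f); rewrite -!gE => /perm_inj/fI.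
by exists (perm gI) => u; rewrite permE.
Qed.

Section Glue.
Variables (U V T : finType) (f : U -> T) (g : V -> T).
Hypotheses (fI : injective f) (gI : injective g).
Hypothesis fg : forall u v, f u != g v.
Hypothesis fgT : forall y, (exists u, y = f u) \/ (exists v, y = g v).

(** The last branch is never reached, as the images of [f] and [g] cover [T]. *)
Definition glue_fun (a : {perm U}) (b : {perm V}) (y : T) : T :=
  if [pick u | y == f u] is Some u then f (a u)
  else if [pick v | y == g v] is Some v then g (b v) else y.

Lemma glue_funl a b u : glue_fun a b (f u) = f (a u).
Proof.
rewrite /glue_fun; case: pickP => [u' /eqP/fI-> //|/(_ u)].
by rewrite eqxx.
Qed.

Lemma glue_funr a b v : glue_fun a b (g v) = g (b v).
Proof.
rewrite /glue_fun; case: pickP => [u /eqP E|_].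
  by have := fg u v; rewrite E eqxx.
by case: pickP => [v' /eqP/gI-> //|/(_ v)]; rewrite eqxx.
Qed.

Lemma glue_inj a b : injective (glue_fun a b).
Proof.
move=> y z; have [[u ->]|[u ->]] := fgT y; have [[v ->]|[v ->]] := fgT z;
  rewrite ?glue_funl ?glue_funr.
- by move=> /fI/perm_inj->.
- by move=> E; have := fg (a u) (b v); rewrite E eqxx.
- by move=> E; have := fg (a v) (b u); rewrite E eqxx.
- by move=> /gI/perm_inj->.
Qed.

Definition glue (ab : {perm U} * {perm V}) : {perm T} := perm (@glue_inj ab.1 ab.2).

Lemma gluel ab u : glue ab (f u) = f (ab.1 u).
Proof. by rewrite permE glue_funl. Qed.

Lemma gluer ab v : glue ab (g v) = g (ab.2 v).
Proof. by rewrite permE glue_funr. Qed.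

Let A := [set f u | u in U].

Lemma glue_stable ab : stable (glue ab) A.
Proof.
apply/stableP => _ /imsetP[u _ ->]; rewrite gluel; exact: imset_f.
Qed.

Lemma glue_right_notin v : g v \notin A.
Proof. by apply/imsetP => -[u _ E]; have := fg u v; rewrite E eqxx. Qed.

Lemma glue_injective : injective glue.
Proof.
move=> [a b] [a' b'] E; congr (_, _); apply/permP => u.
  by apply: fI; have /permP/(_ (f u)) := E; rewrite !gluel.
by apply: gI; have /permP/(_ (g u)) := E; rewrite !gluer.
Qed.

Lemma glue_surj s : stable s A -> exists ab, s = glue ab.
Proof.
move=> sA; have [a aE] := perm_restrict fI sA.
have [b bE] : exists b : {perm V}, forall v, s (g v) = g (b v).
  apply: perm_restrict => //; apply/stableP => _ /imsetP[v _ ->].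
  have [[u uE]|[v' ->]] := fgT (s (g v)); last exact: imset_f.
  have : s (g v) \in A by rewrite uE imset_f.
  by rewrite stable_mem // (negPf (glue_right_notin v)).
exists (a, b); apply/permP => y; have [[u ->]|[v ->]] := fgT y.
  by rewrite gluel aE.
by rewrite gluer bE.
Qed.

(** The cycles of a glued permutation are the images of the cycles of its parts. *)
Lemma blockprod_glue (R : realType) (w : nat -> R) ab :
  blockprod w (porbits (glue ab)) =
  blockprod w (porbits ab.1) * blockprod w (porbits ab.2).
Proof.
set P := [set f @: (C : {set U}) | C in porbits ab.1].
set Q := [set g @: (C : {set V}) | C in porbits ab.2].
have -> : porbits (glue ab) = P :|: Q.
  apply/setP => C; rewrite inE; apply/imsetP/orP.
    move=> [y _ ->]; have [[u ->]|[v ->]] := fgT y; [left|right].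
      by rewrite (porbit_transport (gluel ab)) imset_f // imset_f.
    by rewrite (porbit_transport (gluer ab)) imset_f // imset_f.
  case=> /imsetP[_ /imsetP[u _ ->] ->].
    by exists (f u); rewrite // (porbit_transport (gluel ab)).
  by exists (g u); rewrite // (porbit_transport (gluer ab)).
have -> : blockprod w (P :|: Q) = blockprod w P * blockprod w Q.
  rewrite /blockprod -bigU /=; first by apply: eq_bigl => C; rewrite !inE.
  rewrite disjoint_subset; apply/subsetP => _ /imsetP[_ /imsetP[u _ ->] ->].
  rewrite inE; apply/imsetP => -[C _ /setP/(_ (f u))].
  rewrite imset_f ?porbit_id // => /esym/imsetP[v _ E].
  by have := fg u v; rewrite E eqxx.
by rewrite !blockprod_imset.
Qed.

Lemma sum_glue (R : realType) (F : {perm T} -> R) :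
  \sum_(s | stable s A) F s = \sum_ab F (glue ab).
Proof.
have -> : \sum_(s | stable s A) F s = \sum_(s in [set glue ab | ab in [set: {perm U} * {perm V}]]) F s.
  apply: eq_bigl => s; apply/idP/imsetP => [/glue_surj[ab ->]|[ab _ ->]].
    by exists ab.
  exact: glue_stable.
rewrite big_imset /=; last by move=> ? ? _ _; apply: glue_injective.
by apply: eq_bigl => ab; rewrite inE.
Qed.

(** Stable sets containing [f u] and contained in the image of [f] are the images of
    the stable sets containing [u]. *)
Lemma pair_orbit_glue ab cd u :
  (pair_orbit (glue ab) (glue cd) (f u) == A) = transitive_pair ab.1 cd.1.
Proof.
set C := pair_orbit _ _ _.
have [C1 C2] : stable (glue ab) C /\ stable (glue cd) C by apply: pair_orbit_stable.
apply/eqP/idP => [CA|/transitive_pairP H].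
  apply/(transitive_pairP _ _ u) => B B1 B2 uB; apply/setP => x; rewrite inE.
  have : f x \in C by rewrite CA imset_f.
  have stB ef : stable ef.1 B -> stable (glue ef) (f @: B).
    move=> /stableP eB; apply/stableP => _ /imsetP[y yB ->].
    by rewrite gluel imset_f ?eB.
  have /subsetP/[apply] : C \subset f @: B.
    by apply: pair_orbit_sub; rewrite ?stB ?imset_f.
  by rewrite mem_imset.
apply/eqP; rewrite eqEsubset pair_orbit_sub ?glue_stable ?imset_f //=.
have /setP E : f @^-1: C = [set: U].
  apply: (H u); rewrite ?inE ?pair_orbit_id //; apply/stableP => x; rewrite !inE -gluel.
    by rewrite stable_mem.
  by rewrite stable_mem.
by apply/subsetP => _ /imsetP[x _ ->]; have := E x; rewrite !inE.
Qed.

(** A pair with orbit [A] is a transitive pair on [A] glued with an arbitrary pair on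
    the complement. *)
Lemma sum_pair_orbit (R : realType) (F : {perm T} -> {perm T} -> R) u :
  \sum_(p | pair_orbit p.1 p.2 (f u) == A) F p.1 p.2 =
  \sum_ab \sum_(cd | transitive_pair ab.1 cd.1) F (glue ab) (glue cd).
Proof.
rewrite -(pair_big_dep xpredT (fun a b => pair_orbit a b (f u) == A)) /=.
rewrite (bigID (fun s => stable s A)) /= [X in _ + X]big1 ?addr0; last first.
  move=> s sA; rewrite big1 // => s' /eqP cA.
  by have := (pair_orbit_stable s s' (f u)).1; rewrite cA (negPf sA).
rewrite sum_glue; apply: eq_bigr => ab _.
rewrite big_mkcond (bigID (fun s => stable s A)) /= [X in _ + X]big1 ?addr0; last first.
  move=> s sA; case: eqP => // cA.
  by have := (pair_orbit_stable (glue ab) s (f u)).2; rewrite cA (negPf sA).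
rewrite sum_glue [RHS]big_mkcond; apply: eq_bigr => cd _.
by rewrite pair_orbit_glue.
Qed.

End Glue.

(** * Cumulants of sums over permutations *)

Section Recursion.
Variable R : realType.
Implicit Types (e c w v a b : nat -> R).

Lemma card_sets_containing (T : finType) (x : T) (k : nat) :
  #|[set A : {set T} | (x \in A) && (#|A| == k.+1)]| = 'C(#|T|.-1, k).
Proof.
have <- : #|~: [set x]| = #|T|.-1.
  by have := cardsC [set x]; rewrite cards1 => <-.
rewrite -cards_draws -[RHS](@card_in_imset _ _ (fun B : {set T} => x |: B)).
  apply: eq_card => A; rewrite inE; apply/andP/imsetP => [[xA /eqP cA]|[B]].
    exists (A :\ x); last by rewrite setD1K.
    rewrite inE; apply/andP; split; first by rewrite setDE subsetIr.
    by move: cA; rewrite (cardsD1 x A) xA add1n => -[->].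
  rewrite inE => /andP[Bx /eqP cB] ->; rewrite setU11; split=> //.
  rewrite cardsU1 cB; suff -> : x \notin B by [].
  by apply/negP => /(subsetP Bx); rewrite !inE eqxx.
move=> B C; rewrite !inE => /andP[Bx _] /andP[Cx _] E.
have nx (D : {set T}) : D \subset ~: [set x] -> x \notin D.
  by move=> /subsetP Dx; apply/negP => /Dx; rewrite !inE eqxx.
by rewrite -(setU1K (nx _ Bx)) E setU1K ?nx.
Qed.

(** Turns sums over the possible orbits, or blocks, of a point into the sums of
    [cumulant_rec]. *)
Lemma sum_sets_containing (T : finType) (x : T) (phi : nat -> R) :
  \sum_(A : {set T} | x \in A) phi #|A| =
  \sum_(k < #|T|) 'C(#|T|.-1, k)%:R * phi k.+1.
Proof.
transitivity (\sum_(A : {set T} | x \in A) \sum_(k < #|T| | #|A| == k.+1) phi k.+1).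
  apply: eq_bigr => A xA.
  have A0 : (0 < #|A|)%N by rewrite (cardsD1 x) xA.
  have AT : (#|A|.-1 < #|T|)%N by apply: leq_trans (max_card A); rewrite ltn_predL.
  rewrite (big_pred1 (Ordinal AT)) /= ?(ltn_predK A0) // => k /=.
  by rewrite -[RHS]val_eqE /= eq_sym -[X in _ == X](ltn_predK A0) eqSS.
rewrite (exchange_big_dep xpredT) //=; apply: eq_bigr => k _.
rewrite sumr_const -(card_sets_containing x).
by rewrite mulr_natl; congr (_ *+ _); apply: eq_card => A; rewrite !inE.
Qed.

(** The relation between moments [e] and classical cumulants [c]: the exponential
    generating function of [e] is the exponential of the one of [c].  The bound [N] is
    there because the coefficients of a polynomial of degree [d] satisfy such a
    relation only up to index [d]. *)
Definition cumulant_rec N e c := forall n, (n < N)%N ->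
  e n.+1 = \sum_(k < n.+1) 'C(n, k)%:R * c k.+1 * e (n - k)%N.

(** As [e 0 = 1], [c n.+1] enters the equation for [e n.+1] with coefficient 1. *)
Lemma cumulant_rec_uniqr N e e' c c' : e 0%N = 1 -> (forall n, (n <= N)%N -> e n = e' n) ->
  cumulant_rec N e c -> cumulant_rec N e' c' -> forall n, (n < N)%N -> c n.+1 = c' n.+1.
Proof.
move=> e0 ee H H'; elim/ltn_ind => n IH nN.
have := H n nN; rewrite ee // H' // !big_ord_recr /= subnn binn -!ee // e0 !mul1r !mulr1.
have -> : \sum_(i < n) 'C(n, i)%:R * c' i.+1 * e' (n - i)%N =
          \sum_(i < n) 'C(n, i)%:R * c i.+1 * e (n - i)%N.
  apply: eq_bigr => i _; rewrite IH ?(ltn_trans _ nN) // ee //.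
  by rewrite (leq_trans (leq_subr _ _)) // ltnW.
by move=> /addrI.
Qed.

Lemma cumulant_rec_uniql N e e' c c' : e 0%N = e' 0%N ->
  (forall n, (n < N)%N -> c n.+1 = c' n.+1) ->
  cumulant_rec N e c -> cumulant_rec N e' c' -> forall n, (n <= N)%N -> e n = e' n.
Proof.
move=> e0 cc H H'; elim/ltn_ind => -[//|n] IH nN.
rewrite H // H' //; apply: eq_bigr => i _.
rewrite cc ?IH ?ltnS ?leq_subr //; first by rewrite (leq_trans (leq_subr _ _)) // ltnW.
exact: leq_trans (ltn_ord i) nN.
Qed.

Definition perm_sum w n := \sum_(s : 'S_n) blockprod w (porbits s).

Definition transitive_sum w v n := \sum_(s : 'S_n) \sum_(u : 'S_n | transitive_pair s u)
  blockprod w (porbits s) * blockprod v (porbits u).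

Lemma perm_sum0 w : perm_sum w 0 = 1.
Proof.
rewrite /perm_sum (big_pred1 (1%g : 'S_0)); last first.
  by move=> s /=; apply/esym/eqP/permP => -[].
rewrite /blockprod big_pred0 // => C; by apply/imsetP => -[[m]].
Qed.

(** Sorting the pairs of permutations by the orbit of [ord0] shows that the cumulants
    of a product of two sums over permutations are the sums over transitive pairs. *)
Lemma cumulant_rec_transitive_sum w v N :
  cumulant_rec N (fun n => perm_sum w n * perm_sum v n) (transitive_sum w v).
Proof.
move=> n _; set x := ord0 : 'I_n.+1.
pose F (s u : 'S_n.+1) := blockprod w (porbits s) * blockprod v (porbits u).
transitivity (\sum_p F p.1 p.2).
  by rewrite -(pair_big xpredT xpredT) /= mulr_suml; apply: eq_bigr => s _; rewrite mulr_sumr.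
(* the orbit of [x] is identified with ['I_#|A|], and its complement similarly *)
rewrite (partition_big (fun p => pair_orbit p.1 p.2 x) (fun A => x \in A)) /=; last first.
  by move=> p _; apply: pair_orbit_id.
transitivity (\sum_(A : {set 'I_n.+1} | x \in A) transitive_sum w v #|A| *
    (perm_sum w (n.+1 - #|A|) * perm_sum v (n.+1 - #|A|))); last first.
  rewrite (sum_sets_containing x (fun k => transitive_sum w v k *
    (perm_sum w (n.+1 - k) * perm_sum v (n.+1 - k)))) card_ord /=.
  by apply: eq_bigr => k _; rewrite subSS mulrA.
apply: eq_bigr => A xA.
pose f : 'I_#|A| -> 'I_n.+1 := enum_val.
pose g : 'I_#|~: A| -> 'I_n.+1 := enum_val.
have fI : injective f by apply: enum_val_inj.
have gI : injective g by apply: enum_val_inj.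
have fg i j : f i != g j.
  apply/eqP => E; have fiA : f i \in A by apply: enum_valP.
  have : g j \in ~: A by apply: enum_valP.
  by rewrite inE -E fiA.
have fgT y : (exists i, y = f i) \/ (exists j, y = g j).
  have [yA|yA] := boolP (y \in A); [left|right].
    by exists (enum_rank_in yA y); rewrite /f enum_rankK_in.
  have yA' : y \in ~: A by rewrite inE.
  by exists (enum_rank_in yA' y); rewrite /g enum_rankK_in.
have fA : [set f i | i in 'I_#|A|] = A.
  apply/setP => y; apply/imsetP/idP => [[i _ ->]|yA]; first exact: enum_valP.
  by exists (enum_rank_in yA y); rewrite /f ?enum_rankK_in.
have [i xi] : exists i, x = f i by exists (enum_rank_in xA x); rewrite /f enum_rankK_in.
have cA : #|~: A| = (n.+1 - #|A|)%N.
  by rewrite -[X in (X - _)%N](card_ord n.+1) -(cardsC A) addKn.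
rewrite -cA xi -{1}fA (sum_pair_orbit fI gI fg fgT F i).
transitivity (\sum_(ab : 'S_#|A| * 'S_#|~: A|) \sum_(cd : 'S_#|A| * 'S_#|~: A| | transitive_pair ab.1 cd.1)
    (blockprod w (porbits ab.1) * blockprod v (porbits cd.1) *
     (blockprod w (porbits ab.2) * blockprod v (porbits cd.2)))).
  by apply: eq_bigr => ab _; apply: eq_bigr => cd _; rewrite /F !blockprod_glue mulrACA.
rewrite -(pair_big xpredT xpredT (fun (a : 'S_#|A|) (b : 'S_#|~: A|) =>
  \sum_(cd : 'S_#|A| * 'S_#|~: A| | transitive_pair a cd.1)
    (blockprod w (porbits a) * blockprod v (porbits cd.1) *
     (blockprod w (porbits b) * blockprod v (porbits cd.2))))) /=.
rewrite /transitive_sum mulr_suml; apply: eq_bigr => a _.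
rewrite exchange_big /= mulr_suml.
rewrite (eq_bigl (fun cd => transitive_pair a cd.1 && xpredT cd.2)); last by move=> cd; rewrite andbT.
rewrite -(pair_big (transitive_pair a) xpredT (fun (c : 'S_#|A|) (d : 'S_#|~: A|) =>
  \sum_(b : 'S_#|~: A|) (blockprod w (porbits a) * blockprod v (porbits c) *
     (blockprod w (porbits b) * blockprod v (porbits d))))) /=.
apply: eq_bigr => c _; rewrite exchange_big /perm_sum mulr_suml mulr_sumr /=.
by apply: eq_bigr => b _; rewrite -!mulr_sumr.
Qed.

End Recursion.

(** * Cumulants as sums over set partitions *)

Section PartitionCumulants.
Variable R : realType.
Implicit Types (e : nat -> R).

(** The Moebius function of the lattice of partitions, between a partition with [k]
    blocks and the one-block partition. *)
Definition mobius (k : nat) : R := (-1) ^+ k.-1 * (k.-1)`!%:R.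

Definition partition_cumulant_on e (T : finType) (A : {set T}) : R :=
  \sum_(P | partition P A) mobius #|P| * blockprod e P.

Definition partition_cumulant e n := partition_cumulant_on e [set: 'I_n].

Lemma partition_cumulant_card e (T : finType) (A : {set T}) :
  partition_cumulant_on e A = partition_cumulant e #|A|.
Proof.
pose f : 'I_#|A| -> T := enum_val.
have fI : injective f by apply: enum_val_inj.
have fA : [set f i | i in [set: 'I_#|A|]] = A.
  apply/setP => y; apply/imsetP/idP => [[i _ ->]|yA]; first exact: enum_valP.
  by exists (enum_rank_in yA y); rewrite /f ?enum_rankK_in.
pose F (P : {set {set 'I_#|A|}}) := [set f @: (C : {set 'I_#|A|}) | C in P].
have FI : injective F by apply/imset_inj/imset_inj.
have FE P : partition (F P) A = partition P [set: 'I_#|A|].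
  by rewrite -(imset_partition P [set: 'I_#|A|] fI) fA.
rewrite /partition_cumulant_on.
have -> : \sum_(P | partition P A) mobius #|P| * blockprod e P =
    \sum_(P in [set F Q | Q in [set Q | partition Q [set: 'I_#|A|]]])
       mobius #|P| * blockprod e P.
  apply: eq_bigl => P; apply/idP/imsetP => [PA|[Q]]; last by rewrite inE -FE => ? ->.
  have PE : P = F [set f @^-1: C | C : {set T} in P].
    rewrite /F -imset_comp -[LHS]imset_id; apply: eq_in_imset => C CP /=.
    apply/setP => y; apply/idP/imsetP => [yC|[i]]; last by rewrite inE => ? ->.
    have yA : y \in A by rewrite (subsetP (partitionS PA CP)).
    by exists (enum_rank_in yA y); rewrite ?inE /f enum_rankK_in.
  by exists [set f @^-1: C | C : {set T} in P]; rewrite // inE -FE -PE.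
rewrite big_imset /=; last by move=> P Q _ _; apply: FI.
apply: eq_big => [Q|Q _]; first by rewrite inE.
by rewrite card_imset ?blockprod_imset //; apply: imset_inj.
Qed.

Lemma blockprod1 e (T : finType) (A : {set T}) : blockprod e [set A] = e #|A|.
Proof. by rewrite /blockprod big_set1. Qed.

Lemma blockprodD1 e (T : finType) (P : {set {set T}}) A : A \in P ->
  blockprod e P = e #|A| * blockprod e (P :\ A).
Proof. by move=> AP; rewrite /blockprod (big_setD1 A). Qed.

Lemma partitionC (T : finType) (P : {set {set T}}) A :
  partition P [set: T] -> A \in P -> partition (P :\ A) (~: A).
Proof. by move=> /partitionD1 H /H; rewrite setTD. Qed.

(** In [sum_partition_cumulant] a partition with [k] blocks occurs once by itself, and
    once for each of the [k.-1] blocks that may be removed from it. *)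
Lemma mobius_rec k : (0 < k)%N -> mobius k + (k.-1)%:R * mobius k.-1 = (k == 1)%:R.
Proof.
case: k => // -[|k] _; first by rewrite /mobius /= expr0 mul1r mul0r addr0.
by rewrite /mobius /= exprS factS natrM; ring.
Qed.

(** A partition of a proper subset [A] containing [ord0] amounts to the partition of
    the whole set obtained by adding the block [~: A], with this block marked; the
    marked block can be any block avoiding [ord0].  By [mobius_rec] the total weight
    of a partition then vanishes, unless it has one block. *)
Lemma sum_partition_cumulant e n : e 0%N = 1 ->
  e n.+1 = \sum_(A : {set 'I_n.+1} | ord0 \in A) partition_cumulant e #|A| * e (n.+1 - #|A|)%N.
Proof.
move=> e0.
pose T := 'I_n.+1; pose x := ord0 : T.
have cC (A : {set T}) : (n.+1 - #|A|)%N = #|~: A|.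
  by rewrite -[X in (X - _)%N](card_ord n.+1) -(cardsC A) addKn.
transitivity (\sum_(A : {set T} | x \in A) \sum_(P | partition P A) 
     mobius #|P| * (e #|~: A| * blockprod e P)); last first.
  apply: eq_bigr => A xA; rewrite -partition_cumulant_card /partition_cumulant_on.
  by rewrite cC mulr_suml; apply: eq_bigr => P _; ring.
(* [A = T] gives the term of the partition itself, the other [A] the marked blocks *)
rewrite (bigD1 [set: T]) /= ?inE // setCT cards0 e0.
rewrite (pair_big_dep _ (fun A P => partition P A)) /=.
pose h (p : {set T} * {set {set T}}) := (~: p.1, p.2 :\ p.1).
pose h' (p : {set T} * {set {set T}}) := (~: p.1, (~: p.1) |: p.2).
rewrite (reindex_onto h h') /=; last first.
  move=> [A P] /= /andP[/andP[xA AT] PA]; rewrite /h /h' /= setCK setU1K //.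
  apply/negP => /(partitionS PA) /subsetP AA; case/negP: AT; apply/eqP/setP => y.
  by rewrite inE; case: (boolP (y \in A)) => // yA; have := AA y; rewrite inE yA (negPf yA) => /(_ isT).
rewrite (eq_bigl (fun p : {set T} * {set {set T}} =>
   partition p.2 [set: T] && ((p.1 \in p.2) && (x \notin p.1)))); last first.
  move=> [B P]; rewrite /h /h' /= setCK inE.
  apply/idP/idP.
    case/andP => /andP[/andP[xB BT] PB] /eqP[PE].
    have BP : B \in P by rewrite -PE setU11.
    rewrite BP xB !andbT -PE -(setUCr B); apply: partitionU1 => //.
      by apply: contraNneq BT => ->; rewrite setC0.
    by rewrite -setI_eq0 setICr.
  case/and3P => PT BP xB; rewrite setD1K // eqxx xB partitionC //= andbT.
  rewrite andbT; apply: contraNneq (partition_neq0 PT BP) => BT.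
  by rewrite -[B]setCK BT setCT.
rewrite -(pair_big_dep (fun _ => true) (fun B P => partition P [set: T] && ((B \in P) && (x \notin B)))
  (fun B P => mobius #|P :\ B| * (e #|~: ~: B| * blockprod e (P :\ B)))) /=.
(* group by the partition; its blocks avoiding [x] are all but [pblock P x] *)
rewrite (exchange_big_dep (fun P => partition P [set: T])) /=; last by move=> ? ? _ /andP[].
rewrite -big_split /=.
have key P : partition P [set: T] -> mobius #|P| * (1 * blockprod e P) +
    \sum_(B | partition P [set: T] && ((B \in P) && (x \notin B)))
      mobius #|P :\ B| * (e #|~: ~: B| * blockprod e (P :\ B)) =
    (#|P| == 1)%:R * blockprod e P.
  move=> PT; rewrite PT /= mul1r.
  rewrite (eq_bigr (fun _ => mobius #|P|.-1 * blockprod e P)); last first.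
    move=> B /andP[BP _]; rewrite setCK -blockprodD1 //.
    by rewrite (cardsD1 B P) BP.
  rewrite sumr_const.
  have xP : pblock P x \in P by rewrite pblock_mem // (cover_partition PT).
  have -> : #|(fun B => (B \in P) && (x \notin B))| = #|P|.-1.
    rewrite (cardsD1 (pblock P x) P) xP /=; apply: eq_card => B.
    rewrite in_setD1 -[LHS]/((B \in P) && (x \notin B)).
    case BP: (B \in P); rewrite ?andbF ?andbT //=.
    congr (~~ _); apply/idP/eqP => [xB|->].
      by rewrite (def_pblock (partition_trivIset PT) BP xB).
    by rewrite mem_pblock (cover_partition PT).
  have P0 : (0 < #|P|)%N by rewrite card_gt0; apply/set0Pn; exists (pblock P x).
  by rewrite -(mobius_rec P0) mulrDl; congr (_ + _); rewrite -[RHS]mulrA [RHS]mulr_natl.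
rewrite (eq_bigr _ key) (bigD1 [set [set: T]]) /=; last first.
  rewrite /partition cover1 eqxx trivIset1 inE /=.
  by apply/eqP => /setP/(_ x); rewrite !inE.
rewrite cards1 mul1r blockprod1 cardsT card_ord big1 ?addr0 // => P /andP[PT P1].
case: eqP => [/eqP/cards1P[B PE]|]; last by rewrite mul0r.
case/negP: P1; rewrite PE; have := cover_partition PT.
by rewrite PE cover1 => ->.
Qed.

Lemma cumulant_rec_partition e N : e 0%N = 1 -> cumulant_rec N e (partition_cumulant e).
Proof.
move=> e0 n _; rewrite sum_partition_cumulant //.
rewrite (sum_sets_containing ord0 (fun k => partition_cumulant e k * e (n.+1 - k)%N)).
by rewrite card_ord; apply: eq_bigr => k _; rewrite subSS mulrA.
Qed.

End PartitionCumulants.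

(** * Sums over permutations with one or two cycles *)

Section PermConj.
Variable T : finType.
Implicit Types (s g h : {perm T}) (x y : T).

Lemma conj_eqP s h g : reflect (forall x, g (h x) = h (s x)) ((s ^ h)%g == g).
Proof.
apply: (iffP eqP) => [<- x|H]; first exact: permJ.
by apply/permP => y; rewrite -(permKV h y) permJ H.
Qed.

Lemma perm_surj h y : exists x, y = h x.
Proof. by exists ((h^-1)%g y); rewrite permKV. Qed.

Lemma porbitsJ s h :
  porbits (s ^ h)%g = [set h @: (C : {set T}) | C in porbits s].
Proof. by apply: porbits_transport (perm_surj h) => x; rewrite permJ. Qed.

Lemma card_porbitsJ s h : #|porbits (s ^ h)%g| = #|porbits s|.
Proof. by rewrite porbitsJ card_imset //; apply/imset_inj/perm_inj. Qed.

Lemma blockprodJ (R : realType) (w : nat -> R) s h :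
  blockprod w (porbits (s ^ h)%g) = blockprod w (porbits s).
Proof. by rewrite porbitsJ blockprod_imset //; apply: perm_inj. Qed.

Lemma stableJ s h (A : {set T}) : stable (s ^ h)%g (h @: A) = stable s A.
Proof.
apply/stableP/stableP => H x xA.
  by have := H (h x); rewrite permJ !mem_imset ?xA //; try exact: perm_inj; apply.
by have /imsetP[y yA ->] := xA; rewrite permJ imset_f ?H.
Qed.

Lemma transitive_pairJ_sub s u h : transitive_pair s u -> transitive_pair (s ^ h)%g (u ^ h)%g.
Proof.
case: (pickP (fun x : T => true)) => [x0 _|T0]; last first.
  by have -> : h = 1%g; [apply/permP => x; have := T0 x | rewrite !conjg1].
move/(transitive_pairP _ _ x0) => H; apply/(transitive_pairP _ _ (h x0)) => A sA uA xA.
have AE : A = h @: (h @^-1: A).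
  apply/setP => y; have [x ->] := perm_surj h y.
  by rewrite mem_imset ?inE //; apply: perm_inj.
rewrite AE !stableJ in sA uA; rewrite AE (H (h @^-1: A)) ?inE //.
by apply/setP => y; have [x ->] := perm_surj h y; rewrite imset_f ?inE.
Qed.

Lemma partition_porbits s : partition (porbits s) [set: T].
Proof.
apply/and3P; split.
- rewrite /cover; apply/eqP/setP => x; rewrite inE; apply/bigcupP.
  by exists (porbit s x); [apply: imset_f | apply: porbit_id].
- apply/trivIsetP => _ _ /imsetP[x _ ->] /imsetP[y _ ->].
  apply: contraR => /pred0Pn[z /andP[/= zx zy]]; rewrite -eq_porbit_mem in zx.
  by rewrite -(eqP zx) eq_porbit_mem.
- by apply/imsetP => -[x _ /setP/(_ x)]; rewrite inE porbit_id.
Qed.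

Lemma pblock_porbits s x : pblock (porbits s) x = porbit s x.
Proof.
apply: def_pblock (imset_f _ _) (porbit_id s x) => //.
exact: partition_trivIset (partition_porbits s).
Qed.

Lemma expg_porbit s x : (s ^+ #|porbit s x|)%g x = x.
Proof. by rewrite permX iter_porbit. Qed.

Lemma expg_porbit_inj s x i j : (i < #|porbit s x|)%N -> (j < #|porbit s x|)%N ->
  (s ^+ i)%g x = (s ^+ j)%g x -> i = j.
Proof.
move=> ix jx; rewrite !permX -(nth_traject s ix x) -(nth_traject s jx x) => /eqP.
by rewrite nth_uniq ?size_traject ?uniq_traject_porbit // => /eqP.
Qed.

Lemma conj_expg s h g i x : (s ^ h)%g = g -> (g ^+ i)%g (h x) = h ((s ^+ i)%g x).
Proof. by move=> <-; rewrite -conjXg permJ. Qed.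

End PermConj.

Section ClassSums.

Lemma gamma_expg m k (i : 'I_m.+1) : (gamma m.+1 ^+ k)%g i = ((i + k) %% m.+1)%N :> nat.
Proof.
elim: k => [|k IH]; first by rewrite perm1 addn0 modn_small.
by rewrite expgSr permM /gamma permE /= IH -addn1 modnDml addn1 addnS.
Qed.

Lemma gamma_from0 m (i : 'I_m.+1) : (gamma m.+1 ^+ i)%g ord0 = i.
Proof. by apply: val_inj; rewrite /= gamma_expg add0n modn_small. Qed.

Lemma card_porbits_gamma m : #|porbits (gamma m.+1)| = 1%N.
Proof.
apply/eqP/cards1P; exists (porbit (gamma m.+1) ord0); apply/setP => C; rewrite inE.
apply/imsetP/eqP => [[i _ ->]|->]; last by exists ord0.
by rewrite -(gamma_from0 i) porbit_perm.
Qed.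

(** A conjugator is determined by the image of [ord0], which is arbitrary. *)
Lemma card_conj_cycle m (g : 'S_m.+1) : #|porbits g| = 1%N ->
  #|[set h | (gamma m.+1 ^ h)%g == g]| = m.+1.
Proof.
move=> g1.
have gT x : #|porbit g x| = m.+1.
  rewrite -[RHS]card_ord; apply: eq_card => y; rewrite inE; exact: porbits1P.
rewrite -[RHS]card_ord -cardsT -(@card_in_imset _ _ (fun h : 'S_m.+1 => h ord0)).
  apply: eq_card => x; rewrite [RHS]inE; apply/imsetP.
  pose f (i : 'I_m.+1) := (g ^+ i)%g x.
  have fI : injective f.
    by move=> i j /expg_porbit_inj E; apply: val_inj; apply: E; rewrite gT.
  exists (perm fI); last by rewrite permE /f perm1.
  rewrite inE; apply/conj_eqP => i; rewrite !permE /f /= -permM -expgSr.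
  have [im|] := ltnP i.+1 m.+1; first by rewrite modn_small.
  rewrite leq_eqVlt ltnS => /predU1P[|]; last by rewrite ltnNge -ltnS ltn_ord.
  by move=> <-; rewrite modnn perm1; have := expg_porbit g x; rewrite gT.
move=> h h'; rewrite !inE => /eqP hg /eqP hg' E; apply/permP => i.
by rewrite -(gamma_from0 i) -(conj_expg i ord0 hg) -(conj_expg i ord0 hg') E.
Qed.

Variable R : realType.

(** Double counting over the conjugates of [d]. *)
Lemma sum_conj (T : finType) (f : {perm T} -> R) (d : {perm T}) :
  (forall g h, f (g ^ h)%g = f g) ->
  #|T|`!%:R * f d = \sum_g #|[set h | (d ^ h)%g == g]|%:R * f g.
Proof.
move=> fJ; transitivity (\sum_(h : {perm T}) f (d ^ h)%g).
  rewrite (eq_bigr (fun _ => f d)) // sumr_const mulr_natl; congr (_ *+ _).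
  rewrite -cardsT -(card_perm [set: T]); apply: eq_card => s.
  by rewrite [LHS]unfold_in [RHS]unfold_in /=; apply/subsetP => x; rewrite inE.
rewrite (partition_big (fun h => (d ^ h)%g) xpredT) //=; apply: eq_bigr => g _.
rewrite (eq_bigr (fun _ => f g)) => [|h /eqP -> //].
by rewrite sumr_const mulr_natl; congr (_ *+ _); apply: eq_card => h; rewrite inE.
Qed.

Lemma sum_cycles m (f : 'S_m.+1 -> R) : (forall g h, f (g ^ h)%g = f g) ->
  \sum_(g | #|porbits g| == 1%N) f g = m`!%:R * f (gamma m.+1).
Proof.
move=> fJ; have m0 : m.+1%:R != 0 :> R by rewrite pnatr_eq0.
apply: (mulfI m0); rewrite mulrA -natrM -factS -[X in X`!](card_ord m.+1) sum_conj //.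
rewrite mulr_sumr [LHS]big_mkcond; apply: eq_bigr => g _.
case: eqP => [g1|g1]; first by rewrite card_conj_cycle.
rewrite (_ : [set h | _] = set0) ?cards0 ?mul0r //; apply/setP => h; rewrite !inE.
by apply: contra_notF g1 => /eqP <-; rewrite card_porbitsJ card_porbits_gamma.
Qed.

Lemma gamma2l t s (i : 'I_t) : gamma2 t s (lshift s i) = lshift s (ordS i).
Proof. by rewrite permE /gamma2_fun (unsplitK (inl i)). Qed.

Lemma gamma2r t s (j : 'I_s) : gamma2 t s (rshift t j) = rshift t (ordS j).
Proof. by rewrite permE /gamma2_fun (unsplitK (inr j)). Qed.

Lemma gamma2_expgl t s m (i : 'I_t.+1) :
  (gamma2 t.+1 s ^+ m)%g (lshift s i) = lshift s ((gamma t.+1 ^+ m)%g i).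
Proof.
elim: m => [|m IH]; first by rewrite !perm1.
by rewrite !expgSr !permM IH gamma2l [gamma _ _]permE.
Qed.

Lemma gamma2_expgr t s m (j : 'I_s.+1) :
  (gamma2 t s.+1 ^+ m)%g (rshift t j) = rshift t ((gamma s.+1 ^+ m)%g j).
Proof.
elim: m => [|m IH]; first by rewrite !perm1.
by rewrite !expgSr !permM IH gamma2r [gamma _ _]permE.
Qed.

Section TwoCycles.
Variables t s : nat.
Local Notation g2 := (gamma2 t.+1 s.+1).
Local Notation x0 := (lshift s.+1 (ord0 : 'I_t.+1)).
Local Notation y0 := (rshift t.+1 (ord0 : 'I_s.+1)).

Lemma porbit_gamma2l : porbit g2 x0 = [set lshift s.+1 i | i : 'I_t.+1].
Proof.
apply/setP => z; apply/porbitP/imsetP => [[m ->]|[i _ ->]].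
  by rewrite gamma2_expgl; exists ((gamma t.+1 ^+ m)%g ord0).
by exists i; rewrite gamma2_expgl gamma_from0.
Qed.

Lemma mem_porbit_gamma2r : y0 \notin porbit g2 x0.
Proof. by rewrite porbit_gamma2l; apply/imsetP => -[i _ /eqP]; rewrite eq_rlshift. Qed.

Lemma card_porbits_gamma2 : #|porbits g2| = 2.
Proof.
rewrite (_ : porbits g2 = [set porbit g2 x0; porbit g2 y0]).
  by rewrite cards2 eq_porbit_mem porbit_sym mem_porbit_gamma2r.
apply/setP => C; apply/imsetP/set2P => [[z _ ->]|[]->]; last 2 first.
- by exists x0.
- by exists y0.
case: (split_ordP z) => [i|j] ->; [left|right].
  by rewrite -(gamma_from0 i) -gamma2_expgl porbit_perm.
by rewrite -(gamma_from0 j) -gamma2_expgr porbit_perm.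
Qed.

Lemma card_porbit_eq (T : finType) (g : {perm T}) k :
  #|[set x | #|porbit g x| == k]| = (k * #|[set C in porbits g | #|C| == k]|)%N.
Proof.
rewrite -sum1dep_card (partition_big (porbit g) (fun C => (C \in porbits g) && (#|C| == k))) /=.
  rewrite mulnC -sum1dep_card big_distrl /=; apply: eq_bigr => C /andP[/imsetP[x _ ->] /eqP xk].
  rewrite mul1n -xk -[RHS]sum1_card; apply: eq_bigl => y.
  by rewrite -eq_porbit_mem; case: (porbit g y =P porbit g x) => [->|_]; rewrite ?eqxx ?andbF.
by move=> x ->; rewrite imset_f.
Qed.

(** A conjugator is determined by the images [x] and [y] of the first points of the two
    cycles: [x] is any point of a cycle of length [t.+1], and [y] any point of the
    other cycle. *)
Lemma card_conj_gamma2 (g : 'S_(t.+1 + s.+1)) : #|porbits g| = 2 ->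
  #|[set h | (g2 ^ h)%g == g]| =
  (t.+1 * s.+1 * #|[set C in porbits g | #|C| == t.+1]|)%N.
Proof.
move=> g_2.
pose S := [set p : 'I_(t.+1 + s.+1) * 'I_(t.+1 + s.+1) |
            (#|porbit g p.1| == t.+1) && (p.2 \notin porbit g p.1)].
transitivity #|S|; last first.
  rewrite mulnAC -card_porbit_eq /S -[LHS]sum1dep_card -(pair_big_dep
    (fun x => #|porbit g x| == t.+1) (fun x y => y \notin porbit g x) (fun _ _ => 1%N)) /=.
  rewrite -sum1dep_card big_distrl /=; apply: eq_bigr => x /eqP xt.
  rewrite mul1n sum1dep_card; have := cardsC (porbit g x); rewrite card_ord xt.
  by move=> /addnI E; apply: etrans E; apply: eq_card => y; rewrite !inE.
rewrite -(@card_in_imset _ _ (fun h : 'S_(t.+1 + s.+1) => (h x0, h y0))); last first.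
  move=> h h'; rewrite !inE => /eqP hg /eqP hg' [Ex Ey]; apply/permP => z.
  case: (split_ordP z) => [i|j] ->.
    rewrite -(gamma_from0 i) -gamma2_expgl.
    by rewrite -(conj_expg i _ hg) -(conj_expg i _ hg') Ex.
  rewrite -(gamma_from0 j) -gamma2_expgr.
  by rewrite -(conj_expg j _ hg) -(conj_expg j _ hg') Ey.
apply: eq_card => -[x y]; rewrite [RHS]inE /=; apply/imsetP/andP.
  move=> [h]; rewrite inE => /conj_eqP hg [-> ->].
  rewrite (porbit_transport hg) card_imset ?mem_imset; try exact: perm_inj.
  rewrite mem_porbit_gamma2r porbit_gamma2l card_imset ?card_ord //.
  exact: lshift_inj.
move=> [/eqP xt yx].
have ys : #|porbit g y| = s.+1.
  have := card_partition (partition_porbits g).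
  have -> : porbits g = [set porbit g x; porbit g y].
    apply/esym/eqP; rewrite eqEcard g_2 cards2 eq_porbit_mem porbit_sym yx andbT.
    by apply/subsetP => C /set2P[]->; apply: imset_f.
  rewrite cardsT card_ord big_setU1 ?big_set1 /= ?xt ?inE; first by move/addnI.
  by rewrite eq_porbit_mem porbit_sym.
pose f (z : 'I_(t.+1 + s.+1)) := match fintype.split z with
  | inl i => (g ^+ i)%g x | inr j => (g ^+ j)%g y end.
have fl i : f (lshift s.+1 i) = (g ^+ i)%g x by rewrite /f (unsplitK (inl i)).
have fr j : f (rshift t.+1 j) = (g ^+ j)%g y by rewrite /f (unsplitK (inr j)).
have fI : injective f.
  have nxy i j : (g ^+ i)%g x != (g ^+ j)%g y.
    apply: contraNneq yx => E; rewrite porbit_sym -eq_porbit_mem.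
    by rewrite -(porbit_perm g i x) E porbit_perm.
  move=> z z'; case: (split_ordP z) => [i|j] ->; case: (split_ordP z') => [i'|j'] ->;
    rewrite ?fl ?fr.
  - move=> /expg_porbit_inj E; congr lshift; apply: val_inj; apply: E; by rewrite xt.
  - by move/eqP; rewrite (negPf (nxy _ _)).
  - by move/eqP; rewrite eq_sym (negPf (nxy _ _)).
  - move=> /expg_porbit_inj E; congr rshift; apply: val_inj; apply: E; by rewrite ys.
have step k z (i : 'I_k.+1) : #|porbit g z| = k.+1 -> (g ^+ ordS i)%g z = g ((g ^+ i)%g z).
  move=> zk; rewrite -permM -expgSr /=.
  have [ik|] := ltnP i.+1 k.+1; first by rewrite modn_small.
  rewrite leq_eqVlt ltnS => /predU1P[|]; last by rewrite ltnNge -ltnS ltn_ord.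
  by move=> <-; rewrite modnn perm1; have := expg_porbit g z; rewrite zk.
exists (perm fI); last by rewrite !permE fl fr !perm1.
rewrite inE; apply/conj_eqP => z; rewrite ![perm fI _]permE.
by case: (split_ordP z) => [i|j] ->; rewrite ?gamma2l ?gamma2r ?fl ?fr step.
Qed.

End TwoCycles.

(** The weights [1 / (t (n - t))] compensate the counts of [card_conj_gamma2], and the
    factor [1 / 2] is due to the two cycles, each of which may come first. *)
Lemma sum_gamma2_fixed t s n (E : (t.+1 + s.+1)%N = n) (f : 'S_n -> R) :
  (forall g h, f (g ^ h)%g = f g) ->
  \sum_(g | #|porbits g| == 2) #|[set C in porbits g | #|C| == t.+1]|%:R * f g =
  n`!%:R * (f (cast_perm E (gamma2 t.+1 s.+1)) / (t.+1%:R * s.+1%:R)).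
Proof.
case: n / E f => f fJ; rewrite cast_perm_id mulrA.
have := sum_conj (gamma2 t.+1 s.+1) fJ; rewrite card_ord => ->.
rewrite big_mkcond mulr_suml; apply: eq_bigr => g _; case: eqP => g2.
  have ts0 : t.+1%:R * s.+1%:R != 0 :> R by rewrite mulf_neq0 ?pnatr_eq0.
  rewrite card_conj_gamma2 // (natrM _ (t.+1 * s.+1)) natrM.
  by rewrite -(mulrA (t.+1%:R * s.+1%:R)) [RHS]mulrAC mulfV // mul1r.
rewrite (_ : [set h | _] = set0) ?cards0 ?mul0r //; apply/setP => h; rewrite !inE.
by apply: contra_notF g2 => /eqP <-; rewrite card_porbitsJ card_porbits_gamma2.
Qed.

Lemma sum_card_cycles n (g : 'S_n) : #|porbits g| = 2 ->
  (\sum_(1 <= t < n) #|[set C in porbits g | #|C| == t]| = 2)%N.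
Proof.
move=> g2; under eq_bigr do rewrite -sum1dep_card.
rewrite (exchange_big_dep (fun C => C \in porbits g)) /=; last by move=> ? ? _ /andP[].
rewrite -[RHS]g2 -sum1_card; apply: eq_bigr => C Cg.
have part := partition_porbits g.
rewrite (eq_bigl (pred1 #|C|)) => [|t /=]; last by rewrite Cg eq_sym.
rewrite sum1_count count_uniq_mem ?iota_uniq // mem_index_iota.
rewrite card_gt0 (partition_neq0 part Cg) /=.
have [D Dg DC] : exists2 D, D \in porbits g & D != C.
  have : porbits g :\ C != set0 by rewrite -card_gt0; move: g2; rewrite (cardsD1 C) Cg; case: #|_|.
  by case/set0Pn => D; rewrite in_setD1 => /andP[DC Dg]; exists D.
have := card_partition part; rewrite cardsT card_ord (big_setD1 C) //= (big_setD1 D) /= ?inE ?DC //.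
have : (0 < #|D|)%N by rewrite card_gt0 (partition_neq0 part Dg).
by move=> D0 nE; suff -> : (#|C| < n)%N by []; rewrite [X in (_ < X)%N]nE -[X in (X < _)%N]addn0 ltn_add2l addn_gt0 D0.
Qed.

Lemma sum_gamma2 n (f : 'S_n -> R) (phi : nat -> R) :
  (forall g h, f (g ^ h)%g = f g) ->
  (forall t s (E : (t + s)%N = n), phi t = f (cast_perm E (gamma2 t s))) ->
  \sum_(g | #|porbits g| == 2) f g =
  n`!%:R / 2 * \sum_(1 <= t < n) phi t / (t%:R * (n - t)%:R).
Proof.
move=> fJ phiE.
have two0 : 2 != 0 :> R by rewrite pnatr_eq0.
apply: (mulfI two0); rewrite [RHS](_ : _ = n`!%:R * \sum_(1 <= t < n) phi t / (t%:R * (n - t)%:R)); last by field.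
rewrite mulr_sumr.
transitivity (\sum_(1 <= t < n) \sum_(g | #|porbits g| == 2)
    #|[set C in porbits g | #|C| == t]|%:R * f g).
  rewrite exchange_big /= mulr_sumr; apply: eq_bigr => g /eqP g2.
  by rewrite -mulr_suml -natr_sum sum_card_cycles.
apply: eq_big_nat => -[//|t] /andP[_ tn].
have E : (t.+1 + (n - t.+2).+1)%N = n by lia.
have -> : (n - t.+1)%N = (n - t.+2).+1 by lia.
by rewrite (sum_gamma2_fixed E fJ) (phiE _ _ E).
Qed.

End ClassSums.

(** * Noncrossing partitions as geodesic permutations *)

Section NonCrossing.
Local Open Scope nat_scope.
Variable m : nat.
Local Notation n := m.+1.
Local Notation gam := (gamma n).
Implicit Types (s : 'S_n) (P : {set {set 'I_n}}) (V : {set 'I_n}).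

Lemma val_gamma (x : 'I_n) : (x.+1 < n)%N -> gam x = x.+1 :> nat.
Proof. by move=> xn; rewrite permE /= modn_small. Qed.

Lemma val_gammaV (x : 'I_n) : (0 < x)%N -> (gam^-1)%g x = x.-1 :> nat.
Proof.
move=> x0; have xn : (x.-1 < n)%N by have := ltn_ord x; lia.
have -> : x = gam (Ordinal xn).
  by apply: ord_inj; rewrite val_gamma /=; have := ltn_ord x; lia.
by rewrite permK val_gamma /= ?prednK.
Qed.

Definition ord_itv (a b : 'I_n) : {set 'I_n} := [set x : 'I_n | a <= x < b]%N.

(** [tperm a c * gamma^-1] has two cycles, of which this interval is one; stability
    suffices to tell points of different cycles apart. *)
Lemma ord_itv_stable (a c : 'I_n) : (a < c)%N -> stable (tperm a c * gam^-1)%g (ord_itv a c).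
Proof.
move=> ac; apply/stableP => z; rewrite !inE permM => /andP[az zc].
case: tpermP => [_|zE|/eqP za _].
- by rewrite val_gammaV; lia.
- by move: zc; rewrite zE ltnn.
- have za' : (z : nat) != a by [].
  by rewrite val_gammaV; lia.
Qed.

Lemma next_enumP V (i : 'I_n) (k := next (enum V) i) : i \in V -> k \in V /\
  (((i < k)%N /\ forall v, v \in V -> ~~ (i < v < k)%N) \/
   ((k <= i)%N /\ forall v, v \in V -> (k <= v <= i)%N)).
Proof.
move=> iV; have kV : k \in V by rewrite -mem_enum mem_next mem_enum.
(* [enum V] is increasing: positions and values compare alike *)
split=> //; have srt : sorted (relpre val ltn) (enum V).
  rewrite /enum_mem; apply: sorted_filter; first by move=> ? ? ?; apply: ltn_trans.
  by rewrite -enumT -sorted_map val_enum_ord iota_ltn_sorted.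
have tr : transitive (relpre (val : 'I_n -> nat) ltn) by move=> ? ? ?; apply: ltn_trans.
have U := enum_uniq V; have kE : k = next (enum V) i by [].
have is_ : i \in enum V by rewrite mem_enum.
have mono := sorted_ltn_nth tr i srt.
have idx v : v \in V -> (index v (enum V) < size (enum V))%N by rewrite index_mem mem_enum.
have nthi v : v \in V -> nth i (enum V) (index v (enum V)) = v by move=> vV; rewrite nth_index ?mem_enum.
have lei u v : u \in V -> v \in V -> (index u (enum V) < index v (enum V))%N -> (u < v)%N.
  by move=> uV vV uv; have := mono _ _ (idx _ uV) (idx _ vV) uv; rewrite !nthi.
have lei' u v : u \in V -> v \in V -> (u < v)%N -> (index u (enum V) < index v (enum V))%N.
  move=> uV vV uv; rewrite ltnNge leq_eqVlt; apply/negP => /predU1P[E|].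
    by move: uv; rewrite -(nthi _ uV) -E nthi // ltnn.
  by move/(lei _ _ vV uV); lia.
set j := index i (enum V).
have kj : index k (enum V) = if (j.+1 < size (enum V))%N then j.+1 else 0%N.
  move: kE; rewrite next_nth is_; case E: (enum V) => [|y p] in U j *; first by move: is_; rewrite E.
  case: ifP => jp ->.
    by rewrite -[nth y p _]/(nth y (y :: p) j.+1) index_uniq.
  by rewrite nth_default /= ?eqxx //; move: jp; rewrite /j /= ltnS => /negbT; rewrite -leqNgt.
case: ifP kj => jp kj.
  left; split; first by apply: lei => //; rewrite kj.
  move=> v vV; apply/negP => /andP[/(lei' _ _ iV vV) iv /(lei' _ _ vV kV)].
  by rewrite kj; move: iv; rewrite -/j; lia.
right; have kmin v : v \in V -> (k <= v)%N.
  by move=> vV; rewrite leqNgt; apply/negP => /(lei' _ _ vV kV); rewrite kj.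
split; first exact: kmin.
move=> v vV; rewrite kmin //= leqNgt; apply/negP => /(lei' _ _ iV vV).
by have := idx _ vV; rewrite -/j; lia.
Qed.

(** Equality in the triangle inequality for the factorisation of [gamma] into
    [gamma * s^-1] and [s]: in the Cayley graph of the transpositions, [s] lies on a
    geodesic from the identity to [gamma]. *)
Definition geodesic s := #|porbits s| + #|porbits (gam * s^-1)%g| == n.+1.

Lemma porbit_tperm_out s a c d : a \notin porbit s d -> c \notin porbit s d ->
  porbit (s * tperm a c)%g d = porbit s d.
Proof.
move=> ad cd.
have E i : ((s * tperm a c) ^+ i)%g d = (s ^+ i)%g d.
  elim: i => [|i IH]; first by rewrite !perm1.
  rewrite !expgSr !permM IH tpermD //.
    by apply: contraNneq ad => ->; rewrite -permM -expgSr mem_porbit.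
  by apply: contraNneq cd => ->; rewrite -permM -expgSr mem_porbit.
by apply/setP => y; apply/porbitP/porbitP => -[i ->]; exists i; rewrite E.
Qed.

(** Otherwise the transpositions of [a], [c] and of [u], [v] would split cycles of [s]
    twice, shortening it by 2, whereas [gamma^-1] is first split by the one and then
    merged again by the other; this violates the triangle inequality by 2.  Both the
    absence of crossings and the increasing order inside the cycles of [s] are
    instances of this. *)
Lemma geodesic_separates s (a c u v : 'I_n) : geodesic s -> (a < c)%N ->
  a \in porbit s c -> u \in ord_itv a c -> v \notin ord_itv a c ->
  u \notin porbit (s * tperm a c)%g v.
Proof.
move=> /eqP sg ac asc uI vI; apply/negP => uv.
have nac : a != c by rewrite -(inj_eq val_inj) /= neq_ltn ac.
have nuv : u != v by apply: contraTneq uI => ->.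
have r2 := porbits_mulr_tperm_in nuv uv; rewrite (porbits_mulr_tperm_in nac asc) in r2.
have aorb : a \in porbit (gam^-1)%g c.
  by apply: porbits1P; rewrite porbitsV card_porbits_gamma.
(* [gamma^-1] has one cycle: it is split by [a], [c], then merged by [u], [v] *)
have t1 := porbits_mul_tperm_in nac aorb; rewrite porbitsV card_porbits_gamma in t1.
have u2 : u \notin porbit (tperm a c * gam^-1)%g v.
  apply: contra vI => u2.
  by rewrite -(stable_porbit (ord_itv_stable ac) u2).
have t2 := porbits_mul_tperm_out u2; rewrite t1 in t2.
have := porbits_triangle (gam * s^-1)%g (s * tperm a c * tperm u v)%g.
have -> : (gam * s^-1 * (s * tperm a c * tperm u v))%g = ((tperm u v * (tperm a c * gam^-1))^-1)%g.
  by rewrite !invMg !tpermV invgK !mulgA mulgKV.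
rewrite porbitsV r2 card_ord; move: t2 sg; card_lia.
Qed.

Lemma geodesic_NC s : geodesic s -> porbits s \in NC n.
Proof.
move=> sg; rewrite inE inE partition_porbits /=.
apply/forall_inP => V /imsetP[x _ ->{V}]; apply/forall_inP => W /imsetP[y _ ->{W}].
apply/implyP => xy.
apply/forall_inP => a ax; apply/forall_inP => b b_y.
apply/forall_inP => c cx; apply/forall_inP => d dy.
apply/negP => /and3P[ab bc cd].
have ax' := ax; rewrite -eq_porbit_mem in ax'; have dy' := dy; rewrite -eq_porbit_mem in dy'.
have cx' := cx; rewrite -eq_porbit_mem in cx'.
(* split along [a] and [c]: the other cycle, through [b] and [d], is left intact *)
apply: (negP (geodesic_separates (c := c) (u := b) (v := d) sg (ltn_trans ab bc) _ _ _)).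
- by rewrite (eqP cx').
- by rewrite inE ltnW.
- by rewrite inE; lia.
rewrite porbit_tperm_out (eqP dy') //.
  by rewrite -eq_porbit_mem (eqP ax').
by rewrite -eq_porbit_mem (eqP cx').
Qed.

(** If [s i] differed from the element [k] following [i] in its cycle, then splitting
    the cycle along [i] and [k] would leave [i] and [s i] together, although the
    interval bounded by [i] and [k] separates them. *)
Lemma partition_perm_porbits s : geodesic s -> partition_perm (porbits s) = s.
Proof.
move=> sg; apply/permP => i.
rewrite partition_permE ?partition_porbits // pblock_porbits.
set V := porbit s i; have iV : i \in V by apply: porbit_id.
have [kV kspec] := next_enumP iV; set k := next _ _ in kV kspec *.
have jV : s i \in V by apply: mem_porbit1.
apply/eqP/negPn/negP => kj.
have ji : s i != i.
  apply: contraNneq kj => si; have := stable_porbit (_ : stable s [set i]) kV.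
  rewrite !inE eqxx => /(_ _)/eqP -> //; first by rewrite si.
  by apply/stableP => x /set1P->; rewrite inE si.
have jE (a b : 'I_n) : [set a; b] = [set i; k] -> i != k -> (s * tperm a b)%g i = s i.
  move=> ab ik; rewrite permM tpermD //; apply/eqP => E.
    have : a \in [set i; k] by rewrite -ab !inE eqxx.
    by rewrite E !inE (negPf ji) eq_sym (negPf kj).
  have : b \in [set i; k] by rewrite -ab !inE eqxx orbT.
  by rewrite E !inE (negPf ji) eq_sym (negPf kj).
have nij : (i : nat) != s i by rewrite eq_sym.
have nkj : (k : nat) != s i by [].
case: kspec => [[ik kmin]|[ki kmm]].
  have := kmin _ jV => jn.
  have nik : i != k by rewrite -(inj_eq val_inj) /= neq_ltn ik.
  apply: (negP (geodesic_separates (u := i) (v := s i) sg ik _ _ _)).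
  - by rewrite porbit_sym.
  - by rewrite inE leqnn.
  - by rewrite inE; move: jn nij; lia.
  by rewrite -(jE i k) // porbit_sym mem_porbit1.
have := kmm _ jV => jm.
have {}ki : (k < i)%N by move: jm nij; lia.
have nik : i != k by rewrite -(inj_eq val_inj) /= neq_ltn ki orbT.
apply: (negP (geodesic_separates (u := s i) (v := i) sg ki _ _ _)).
- by [].
- by rewrite inE; move: jm nij; lia.
- by rewrite inE ltnn andbF.
by rewrite -(jE k i) ?mem_porbit1 // setUC.
Qed.

(** Points below an ascending arc from [x] to [s x] stay below it.  This form of the
    noncrossing property is inherited by [tperm x (s x) * s], which makes it suitable
    for the induction in [nested_geodesic]. *)
Definition nested s := forall x z : 'I_n, (x < z < s x)%N -> (x < s z < s x)%N.

(** Turning [s x] into a fixed point, where [x < s x], splits a cycle of [s] and merges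
    two cycles of [gamma * s^-1], because the interval from [x] to [s x] is stable
    under the latter.  So the number of cycles in [geodesic] does not change until
    [s] is the identity. *)
Lemma nested_geodesic s : nested s -> geodesic s.
Proof.
have [k] := ubnP (n - #|porbits s|); elim: k s => // k IH s sk sn.
have [->|s1] := eqVneq s 1%g.
  by rewrite /geodesic invg1 mulg1 porbits1 card_porbits_gamma card_ord addn1.
have [x xs] : exists x : 'I_n, (x < s x)%N.
  apply/existsP; apply: contraNT s1 => /existsPn le_s.
  have fix_below j : forall x : 'I_n, (x < j)%N -> s x = x.
    elim: j => // j IHj x xj.
    have := le_s x; rewrite -leqNgt leq_eqVlt => /predU1P[/val_inj//|sx].
    by have /perm_inj := IHj (s x) (leq_trans sx xj).
  by apply/eqP/permP => x; rewrite perm1 (fix_below n).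
set y := s x in xs; have sxx : s x != x by rewrite -(inj_eq val_inj) /= neq_ltn xs orbT.
pose s' := (tperm x y * s)%g.
have s'E : #|porbits s'| = #|porbits s|.+1 by apply: porbits_split.
pose I : {set 'I_n} := [set z : 'I_n | x < z < y]%N.
have sI : stable s I by apply/stableP => z; rewrite !inE; apply: sn.
have s'x : s' x = s y by rewrite permM tpermL.
have s'y : s' y = y by rewrite permM tpermR.
have s'z z : z != x -> z != y -> s' z = s z by move=> zx zy; rewrite permM tpermD // eq_sym.
have sy : ~~ (x < s y < y)%N.
  by have := stable_mem y sI; rewrite !inE ltnn andbF => ->.
(* the arc of [s'] at [x] jumps over [y] when it is ascending, by [sy] *)
have s'n : nested s'.
  move=> u z; have [->|ux] := eqVneq u x.
    rewrite s'x => xz.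
    have sy' : (y < s y)%N.
      have : (s y : nat) != y by apply: contraNneq sxx => /val_inj /perm_inj E; rewrite -/y E.
      by move: sy xz; lia.
    have [zy|zy] := eqVneq z y; first by rewrite zy s'y xs.
    have zx : z != x by rewrite -(inj_eq val_inj) /=; move: xz; lia.
    rewrite s'z //; have [lt_zy|le_yz] := ltnP z y.
      by have := sn x z; rewrite -/y lt_zy; move: xz sy'; lia.
    have zy' : (z : nat) != y by [].
    by have := sn y z; move: xz zy' le_yz xs; lia.
  have [->|uy] := eqVneq u y; first by rewrite s'y; lia.
  rewrite (s'z u) // => uz.
  have [zy|zy] := eqVneq z y; first by rewrite zy s'y -zy.
  have [zx|zx] := eqVneq z x; last by rewrite s'z //; apply: sn.
  by rewrite zx s'x; apply: (sn); apply: (sn); rewrite -zx.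
have ltk : (n - #|porbits s'| < k)%N.
  have := leq_porbits s'; rewrite s'E card_ord; move: sk; card_lia.
have /eqP := IH s' ltk s'n; rewrite /geodesic s'E invMg tpermV mulgA => IH'.
(* [x] lies in the stable interval, [y] does not *)
have xy : x \notin porbit (gam * s^-1)%g y.
  have J : stable (gam * s^-1)%g (ord_itv x y).
    apply/stableP => z; rewrite !inE => /andP[xz zy].
    have zn : (z.+1 < n)%N by have := ltn_ord y; lia.
    rewrite permM; have [zy1|zy1] := eqVneq (z.+1 : nat) y.
      have -> : gam z = y by apply: ord_inj; rewrite val_gamma.
      by rewrite permK leqnn.
    have := stable_mem (gam z) (stableV sI); rewrite !inE val_gamma //.
    by move: xz zy zy1; lia.
  by apply/negP => /(stable_porbit J); rewrite !inE leqnn xs ltnn andbF.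
by have := porbits_mulr_tperm_out xy; move: IH'; rewrite /geodesic -/y => <- <-; rewrite addSnnS.
Qed.

(** [next] runs through the whole of each block. *)
Lemma porbits_partition_perm P : finset.partition P [set: 'I_n] ->
  porbits (partition_perm P) = P.
Proof.
move=> PT; have covP := cover_partition PT.
have ntP := partition_trivIset PT.
have nextP i : partition_perm P i \in pblock P i.
  by rewrite partition_permE // -mem_enum mem_next mem_enum mem_pblock covP.
have st V : V \in P -> stable (partition_perm P) V.
  move=> VP; apply/stableP => i iV.
  by rewrite -(def_pblock ntP VP iV).
have pbE i : porbit (partition_perm P) i = pblock P i.
  have VP : pblock P i \in P by rewrite pblock_mem ?covP.
  have iV : i \in pblock P i by rewrite mem_pblock covP.
  apply/setP => y; apply/idP/idP => [/(stable_porbit (st _ VP)) ->//|yV].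
  have : fcycle (partition_perm P) (enum (pblock P i)).
    have := cycle_next (enum_uniq (pblock P i)); apply: etrans.
    apply: (@eq_in_cycle _ (mem (pblock P i))); last by apply/allP => z; rewrite mem_enum.
    move=> u v uV vV /=; rewrite partition_permE //.
    by rewrite (def_pblock ntP VP uV).
  move=> /fconnect_cycle/(_ i); rewrite mem_enum => /(_ iV)/(_ y).
  rewrite mem_enum yV => /iter_findex <-; rewrite -permX; exact: mem_porbit.
apply/setP => V; apply/imsetP/idP => [[i _ ->]|VP].
  by rewrite pbE pblock_mem ?covP.
have /set0Pn[i iV] := partition_neq0 PT VP.
by exists i; rewrite // pbE (def_pblock ntP VP iV).
Qed.

Lemma NC_nested P : P \in NC n -> nested (partition_perm P).
Proof.
rewrite !inE => /andP[PT /forall_inP ncP] x z /andP[xz zx].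
have covP := cover_partition PT; have ntP := partition_trivIset PT.
have mem_pb i : i \in pblock P i by rewrite mem_pblock covP.
have pbP i : pblock P i \in P by rewrite pblock_mem ?covP.
have xV := mem_pb x; have zW := mem_pb z.
have [x'V xspec] := next_enumP xV; have [z'W _] := next_enumP zW.
rewrite -!partition_permE // in x'V xspec z'W.
set x' := partition_perm P x in zx x'V xspec *.
set z' := partition_perm P z in z'W *.
case: xspec => [[xx' xsucc]|[x'x _]]; last by move: x'x; rewrite leqNgt (ltn_trans xz zx).
have VW : pblock P x != pblock P z.
  by apply/eqP => E; have := xsucc z; rewrite E zW xz zx => /(_ isT).
have crossing V W a b c d : V \in P -> W \in P -> V != W -> a \in V -> b \in W ->
    c \in V -> d \in W -> ~~ [&& a < b, b < c & c < d]%N.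
  move=> VP WP nVW aV bW cV dW.
  have /forall_inP/(_ _ WP)/implyP/(_ nVW)/forall_inP/(_ _ aV) := ncP _ VP.
  by move=> /forall_inP/(_ _ bW)/forall_inP/(_ _ cV)/forall_inP/(_ _ dW).
have disj u : u \in pblock P x -> u \in pblock P z -> False.
  move=> ux uz; case/eqP: VW.
  by rewrite -(def_pblock ntP (pbP x) ux) (def_pblock ntP (pbP z) uz).
have n1 : (z' : nat) != x by apply/eqP => /val_inj E; apply: (disj x) => //; rewrite -E.
have n2 : (z' : nat) != x' by apply/eqP => /val_inj E; apply: (disj x') => //; rewrite -E.
have WV : pblock P z != pblock P x by rewrite eq_sym.
have c1 := crossing _ _ x z x' z' (pbP x) (pbP z) VW xV zW x'V z'W.
have c2 := crossing _ _ z' x z x' (pbP z) (pbP x) WV z'W xV zW x'V.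
by move: c1 c2 n1 n2 xz zx; lia.
Qed.

(** The geodesic permutations are exactly those of the noncrossing partitions
    (Biane). *)
Lemma sum_NC (R : realType) (F : {set {set 'I_n}} -> {set {set 'I_n}} -> R) :
  (\sum_(s | geodesic s) F (porbits s) (porbits (gam * s^-1)%g) =
   \sum_(P in NC n) F P (Kr P))%R.
Proof.
rewrite [RHS](reindex_onto (fun s : 'S_n => porbits s) (@partition_perm n)) /=; last first.
  by move=> P; rewrite !inE => /andP[PT _]; apply: porbits_partition_perm.
rewrite [RHS](eq_bigl (fun s => geodesic s)); last first.
  move=> s; apply/andP/idP => [[sNC /eqP <-]|sg].
    exact/nested_geodesic/NC_nested.
  by rewrite geodesic_NC // partition_perm_porbits.
by apply: eq_bigr => s sg; rewrite /Kr partition_perm_porbits.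
Qed.

End NonCrossing.

(** * Planar and annular pairs of permutations *)

Section ConnectedPairs.
Variable R : realType.
Implicit Types (a b u v w : nat -> R).

Lemma blockderiv_imset (U T : finType) (f : U -> T) v u (P : {set {set U}}) :
  injective f -> blockderiv v u [set f @: (C : {set U}) | C in P] = blockderiv v u P.
Proof.
move=> fI; rewrite /blockderiv big_imset /=; last first.
  by move=> C D _ _; apply: imset_inj.
apply: eq_bigr => C CP; rewrite card_imset //; congr (_ * _).
rewrite -(blockprod_imset u (P :\ C) fI); congr blockprod.
apply/setP => D; rewrite in_setD1; apply/andP/imsetP => [[DC /imsetP[C' C'P DE]]|[C' C'P ->]].
  by exists C'; rewrite // in_setD1 C'P andbT; apply: contraNneq DC => <-; rewrite DE.
move: C'P; rewrite in_setD1 => /andP[C'C C'P].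
by rewrite (inj_eq (imset_inj fI)) imset_f.
Qed.

Definition imset_invariant (T : finType) (F : {set {set T}} -> {set {set T}} -> R) :=
  forall (h : {perm T}) (P Q : {set {set T}}),
    F [set h @: (C : {set T}) | C in P] [set h @: (C : {set T}) | C in Q] = F P Q.

(** The pairs of product [g] with [k] cycles in total.  Fixing the product is useful
    because [k] nearly determines its number of cycles, by [pair_class_genus]. *)
Definition pair_class k (T : finType) (F : {set {set T}} -> {set {set T}} -> R) (g : {perm T}) :=
  \sum_(s : {perm T} | transitive_pair s g && (#|porbits s| + #|porbits (g * s^-1)%g| == k)%N)
    F (porbits s) (porbits (g * s^-1)%g).

Lemma transitive_pairJ (T : finType) (s u h : {perm T}) : transitive_pair (s ^ h)%g (u ^ h)%g = transitive_pair s u.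
Proof.
by apply/idP/idP => [/(transitive_pairJ_sub h^-1)|/transitive_pairJ_sub//]; rewrite !conjgK.
Qed.

Lemma pair_classJ k T F (g h : {perm T}) : imset_invariant F ->
  pair_class k F (g ^ h)%g = pair_class k F g.
Proof.
move=> FI; rewrite /pair_class (reindex_inj (conjg_inj h)) /=.
by apply: eq_big => [s|s _]; rewrite ?transitive_pairJ -conjVg -conjMg ?card_porbitsJ // !porbitsJ.
Qed.

Lemma transitive_pair_cycle (T : finType) (s g : {perm T}) (x : T) : #|porbits g| = 1%N -> transitive_pair s g.
Proof.
move=> g1; apply/(transitive_pairP _ _ x) => A _ gA xA; apply/setP => y; rewrite inE.
by rewrite (stable_porbit gA (porbits1P g1 y x)).
Qed.

Section Fixed.
Variable m : nat.
Local Notation n := m.+1.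

Lemma sum_transitive_class k (F : {set {set 'I_n}} -> {set {set 'I_n}} -> R) :
  \sum_(s : 'S_n) \sum_(u : 'S_n | transitive_pair s u && (#|porbits s| + #|porbits u| == k)%N)
    F (porbits s) (porbits u) = \sum_g pair_class k F g.
Proof.
rewrite /pair_class [RHS](exchange_big_dep xpredT) //=; apply: eq_bigr => s _.
rewrite (reindex_inj (mulIg s^-1)%g) /=; apply: eq_bigl => g.
by rewrite (transitive_pair_mul ord0) mulgKV.
Qed.

Lemma pair_class_genus k F (g : 'S_n) : pair_class k F g != 0 ->
  (k + #|porbits g| <= n.+2)%N /\ ~~ odd (n + (k + #|porbits g|)).
Proof.
move=> pc; have [s] : exists s : 'S_n, transitive_pair s g && (#|porbits s| + #|porbits (g * s^-1)%g| == k)%N.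
  apply/existsP; apply: contraNT pc => /existsPn H.
  by rewrite /pair_class big_pred0 // => s; rewrite (negPf (H s)).
move=> /andP[cs /eqP <-]; have cs' : transitive_pair s (g * s^-1)%g by rewrite (transitive_pair_mul ord0) mulgKV.
by have := genus_inequality ord0 cs'; have := genus_parity s (g * s^-1)%g; rewrite mulgKV card_ord.
Qed.

Lemma porbits_gt0 (g : 'S_n) : (0 < #|porbits g|)%N.
Proof. by rewrite card_gt0; apply/set0Pn; exists (porbit g ord0); apply: imset_f. Qed.

(** For [n.+1] cycles in total the product of the pair is a single cycle, by the genus
    inequality; there are [m`!] such cycles, all conjugate to [gamma]. *)
Lemma sum_transitive_planar F : imset_invariant F ->
  (m`!%:R)^-1 * (\sum_(s : 'S_n)
    \sum_(u : 'S_n | transitive_pair s u && (#|porbits s| + #|porbits u| == n.+1)%N)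
      F (porbits s) (porbits u)) = \sum_(P in NC n) F P (Kr P).
Proof.
move=> FI; rewrite sum_transitive_class (bigID (fun g : 'S_n => #|porbits g| == 1%N)) /=.
rewrite [X in _ + X]big1 ?addr0 => [|g g1]; last first.
  apply/eqP/negPn/negP => /pair_class_genus[+ _].
  by have := porbits_gt0 g; move: g1; card_lia.
rewrite sum_cycles => [|g h]; last exact: pair_classJ.
rewrite mulKf ?pnatr_eq0 -?lt0n ?fact_gt0 // -sum_NC; apply: eq_bigl => s.
by rewrite (transitive_pair_cycle _ ord0) ?card_porbits_gamma.
Qed.

Definition annular a b t s := \sum_(sigma in SNC t s)
  blockprod a (porbits sigma) * blockprod b (porbits (Kr2 sigma)).

(** For [n] cycles in total the product has at most two cycles by the genus
    inequality, and an even number of them by parity. *)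
Lemma sum_transitive_annular a b :
  (m`!%:R)^-1 * (\sum_(s : 'S_n)
    \sum_(u : 'S_n | transitive_pair s u && (#|porbits s| + #|porbits u| == n)%N)
      blockprod a (porbits s) * blockprod b (porbits u)) =
  n%:R / 2 * \sum_(1 <= t < n) annular a b t (n - t) / (t%:R * (n - t)%:R).
Proof.
pose F T (P Q : {set {set T}}) := blockprod a P * blockprod b Q.
have FI T : imset_invariant (@F T).
  by move=> h P Q; rewrite /F !blockprod_imset //; apply: perm_inj.
rewrite (sum_transitive_class n (@F _)) (bigID (fun g : 'S_n => #|porbits g| == 2%N)) /=.
rewrite [X in _ + X]big1 ?addr0 => [|g g2]; last first.
  apply/eqP/negPn/negP => /pair_class_genus[].
  have := porbits_gt0 g; move: g2; case: #|_| => [|[|[|k]]] //= _ _; last by lia.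
  by move=> _; rewrite addn1 !addnS /= !negbK addnn odd_double.
have fJ (g h : 'S_n) : pair_class n (@F _) (g ^ h)%g = pair_class n (@F _) g by apply: pair_classJ.
rewrite (sum_gamma2 (phi := fun t => annular a b t (n - t)) fJ); last first.
  move=> t s E; rewrite -[in LHS]E; case: _ / E; rewrite addKn cast_perm_id.
  by apply: eq_bigl => sigma; rewrite inE.
rewrite factS natrM !mulrA; congr (_ * _); field.
by rewrite pnatr_eq0 -lt0n fact_gt0.
Qed.

End Fixed.

(** A polynomial in [z]: the truncated subtraction is exact on transitive pairs, by
    [genus_inequality].  Its values at [z = - d^-1] are the finite free cumulants of a
    convolution ([cumulant_mul_conv]), and for [b = 1] the moments of a polynomial
    ([poly_moment_series]). *)
Definition pair_series n (z : R) a b :=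
  (n.-1)`!%:R^-1 * \sum_(s : 'S_n) \sum_(u : 'S_n | transitive_pair s u)
    z ^+ (n.+1 - (#|porbits s| + #|porbits u|)) *
    (blockprod a (porbits s) * blockprod b (porbits u)).

Lemma blockprod_scale (T : finType) (s : {perm T}) a z :
  blockprod (fun k => a k * z ^+ k.-1) (porbits s) =
  blockprod a (porbits s) * z ^+ (#|T| - #|porbits s|).
Proof.
rewrite /blockprod big_split /=; congr (_ * _).
rewrite prodrXr; congr (_ ^+ _).
have := card_partition (partition_porbits s); rewrite cardsT => ->.
rewrite -[X in (_ - X)%N]sum1_card -sumnB.
  by apply: eq_bigr => C _; rewrite subn1.
by move=> C Cs; rewrite card_gt0 (partition_neq0 (partition_porbits s)).
Qed.

(** A pair carries [2 n - #|porbits s| - #|porbits u|] factors [z], at least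
    [m = n.-1] of them by [genus_inequality]. *)
Lemma transitive_sum_pair_series m (z : R) a b :
  transitive_sum (fun k => a k * z ^+ k.-1) (fun k => b k * z ^+ k.-1) m.+1 =
  m`!%:R * z ^+ m * pair_series m.+1 z a b.
Proof.
rewrite /pair_series /= mulrAC mulrA mulfV ?mul1r; last by rewrite pnatr_eq0 -lt0n fact_gt0.
rewrite mulr_suml; apply: eq_bigr => s _; rewrite mulr_suml; apply: eq_bigr => u cu.
rewrite !blockprod_scale card_ord mulrACA -exprD [RHS]mulrC [RHS]mulrA -exprD [RHS]mulrC.
congr (_ * _ ^+ _).
have := genus_inequality ord0 cu; have := porbits_gt0 (u * s)%g; rewrite card_ord.
have := leq_porbits s; have := leq_porbits u; rewrite !card_ord; card_lia.
Qed.

End ConnectedPairs.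

From mathcomp Require Import complex.

(** * Finite free cumulants and moments as sums over pairs *)

Section Newton.
Variable F : comNzRingType.
Implicit Types (z : F) (s : seq F).

(** Recursion on the list keeps the index free of any upper bound, and makes
    [elem_sym_nseq1] Pascal's rule. *)
Fixpoint elem_sym s k : F :=
  match s, k with
  | _, 0 => 1
  | [::], _ => 0
  | z :: s', k'.+1 => elem_sym s' k'.+1 + z * elem_sym s' k'
  end.

Lemma elem_sym0 s : elem_sym s 0 = 1. Proof. by case: s. Qed.

Lemma elem_sym_gt s k : (size s < k)%N -> elem_sym s k = 0.
Proof.
elim: s k => [|z s IH] [|k] //= sk.
by rewrite !IH ?mulr0 ?addr0 // ltnW.
Qed.

Lemma elem_sym_coef s k : (k <= size s)%N ->
  (\prod_(z <- s) ('X - z%:P))`_(size s - k) = (-1) ^+ k * elem_sym s k.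
Proof.
elim: s k => [|z s IH] k /=.
  by rewrite leqn0 => /eqP ->; rewrite big_nil coef1 mul1r.
have sP : size (\prod_(z <- s) ('X - z%:P)) = (size s).+1 by rewrite size_prod_XsubC.
rewrite big_cons mulrBl coefB coefXM coefCM; case: k => [|k].
  rewrite subn0 /= => _; rewrite [X in _ - z * X]nth_default ?sP // mulr0 subr0.
  by have := IH 0%N isT; rewrite subn0 elem_sym0.
rewrite ltnS => ks; rewrite subSS IH //.
have -> : (if (size s - k)%N == 0%N then 0 else (\prod_(z <- s) ('X - z%:P))`_(size s - k).-1)
   = (-1) ^+ k.+1 * elem_sym s k.+1.
  have [E|sk] := eqVneq (size s - k)%N 0%N.
    by rewrite elem_sym_gt ?mulr0 //; move: E; lia.
  by rewrite -subnS IH //; move: sk; lia.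
by rewrite exprS; ring.
Qed.

(** The contribution of the power sums of a new variable [z] in [newton]. *)
Lemma newton_telescope z s n :
  \sum_(k < n.+1) (-1) ^+ k * z ^+ k.+1 * elem_sym (z :: s) (n - k) = z * elem_sym s n.
Proof.
elim: n => [|n IH]; first by rewrite big_ord1 /= !elem_sym0; ring.
rewrite big_ord_recl /= expr0 mul1r expr1.
rewrite (eq_bigr (fun k : 'I_n.+1 => - z * ((-1) ^+ k * z ^+ k.+1 * elem_sym (z :: s) (n - k)))); last first.
  by move=> k _; rewrite /bump /= add1n subSS !exprS; ring.
by rewrite -mulr_sumr IH; ring.
Qed.

(** Newton's identities, by induction on the number of variables. *)
Lemma newton s n :
  n.+1%:R * elem_sym s n.+1 =
  \sum_(k < n.+1) (-1) ^+ k * (\sum_(z <- s) z ^+ k.+1) * elem_sym s (n - k).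
Proof.
elim: s n => [|z s IH] n.
  by rewrite mulr0 big1 // => k _; rewrite big_nil mulr0 mul0r.
rewrite (eq_bigr (fun k : 'I_n.+1 =>
    (-1) ^+ k * (\sum_(z <- s) z ^+ k.+1) * elem_sym (z :: s) (n - k) +
    (-1) ^+ k * z ^+ k.+1 * elem_sym (z :: s) (n - k))); last first.
  by move=> k _; rewrite big_cons; ring.
rewrite big_split newton_telescope /=.
suff -> : \sum_(k < n.+1) (-1) ^+ k * (\sum_(z <- s) z ^+ k.+1) * elem_sym (z :: s) (n - k) =
    n.+1%:R * elem_sym s n.+1 + z * (n%:R * elem_sym s n) by rewrite -natr1; ring.
case: n => [|n]; first by rewrite IH !big_ord1 /= !elem_sym0; ring.
rewrite big_ord_recr /= subnn.
rewrite (eq_bigr (fun k : 'I_n.+1 =>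
    (-1) ^+ k * (\sum_(z <- s) z ^+ k.+1) * elem_sym s (n.+1 - k) +
    z * ((-1) ^+ k * (\sum_(z <- s) z ^+ k.+1) * elem_sym s (n - k)))); last first.
  move=> k _; have kn : (k <= n)%N by rewrite -ltnS.
  by rewrite (subSn kn) /=; ring.
rewrite big_split /= -mulr_sumr -IH addrAC; congr (_ + _).
by rewrite IH [RHS]big_ord_recr /= subnn !elem_sym0.
Qed.

Lemma elem_sym_nseq1 d k : elem_sym (nseq d 1) k = 'C(d, k)%:R.
Proof.
elim: d k => [|d IH] [|k] //=.
by rewrite !IH mul1r binS natrD.
Qed.

End Newton.

Section Logrec.
Variable R : realType.
Implicit Types (e c a b : nat -> R).

Lemma cumulant_rec_scale N e c y : cumulant_rec N e c ->
  cumulant_rec N (fun k => e k * y ^+ k) (fun k => c k * y ^+ k).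
Proof.
move=> H n nN; rewrite H // mulr_suml; apply: eq_bigr => k _.
have kn : (k <= n)%N by rewrite -ltnS.
have -> : y ^+ n.+1 = y ^+ k.+1 * y ^+ (n - k) by rewrite -exprD addSn subnKC.
ring.
Qed.

Lemma cumulant_rec_ext N e e' c c' : (forall k, (k <= N)%N -> e k = e' k) ->
  (forall k, (k < N)%N -> c k.+1 = c' k.+1) -> cumulant_rec N e c -> cumulant_rec N e' c'.
Proof.
move=> ee cc H n nN; rewrite -ee // H //; apply: eq_bigr => k _.
rewrite cc ?ee //; first by rewrite (leq_trans (leq_subr _ _)) // ltnW.
exact: leq_trans (ltn_ord k) nN.
Qed.

(** The shape in which Newton's identities are an instance of [cumulant_rec]. *)
Lemma newton_binomial (F : comNzRingType) (s : seq F) n :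
  n.+1`!%:R * elem_sym s n.+1 =
  \sum_(k < n.+1) 'C(n, k)%:R * ((-1) ^+ k * k`!%:R * (\sum_(z <- s) z ^+ k.+1))
     * ((n - k)`!%:R * elem_sym s (n - k)).
Proof.
rewrite factS mulnC natrM -mulrA newton mulr_sumr; apply: eq_bigr => k _.
have kn : (k <= n)%N by rewrite -ltnS.
rewrite -[in LHS](bin_fact kn) !natrM; ring.
Qed.

(** Newton's identities for [d] variables equal to 1. *)
Lemma cumulant_rec_ffact d N : cumulant_rec N (fun k => (d ^_ k)%:R : R)
  (fun k => (-1) ^+ k.-1 * k.-1`!%:R * d%:R).
Proof.
move=> n _; have := newton_binomial (nseq d (1 : R)) n.
rewrite elem_sym_nseq1 mulrC -natrM bin_ffact => ->; apply: eq_bigr => k _.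
rewrite elem_sym_nseq1 [_`!%:R * _]mulrC -natrM bin_ffact /=; congr (_ * (_ * _) * _).
rewrite (eq_big_seq (fun _ => 1)) => [|z /nseqP[-> _]]; last by rewrite expr1n.
by rewrite big_const_seq count_predT size_nseq iter_addr_0.
Qed.

Lemma blockprod_cycle (T : finType) w (s : {perm T}) : #|porbits s| = 1%N ->
  blockprod w (porbits s) = w #|T| :> R.
Proof.
move=> s1; have := card_partition (partition_porbits s); rewrite cardsT.
have /cards1P[C ->] : #|porbits s| == 1%N by apply/eqP.
by rewrite big_set1 /blockprod big_set1 => ->.
Qed.

(** With this weight only the identity counts, so that statements on pairs of
    permutations specialise to single permutations. *)
Definition unit_weight (k : nat) : R := (k == 1%N)%:R.

Lemma blockprod_unit (T : finType) (s : {perm T}) :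
  blockprod unit_weight (porbits s) = (s == 1%g)%:R.
Proof.
have [->|/perm_neq1[x sx]] := eqVneq s 1%g.
  rewrite /blockprod big1 // => _ /imsetP[x _ ->].
  rewrite (_ : porbit 1%g x = [set x]) ?/unit_weight ?cards1 //.
  apply/setP => y; rewrite inE; apply/porbitP/eqP => [[i ->]|->].
    by rewrite expg1n perm1.
  by exists 0%N; rewrite perm1.
rewrite /blockprod (bigD1 (porbit s x)) ?imset_f //= /unit_weight.
rewrite (cardsD1 x) porbit_id (cardsD1 (s x)) in_setD1 sx mem_porbit1 /=.
by rewrite mul0r.
Qed.

Lemma perm_sum_unit n : perm_sum unit_weight n = 1.
Proof.
rewrite /perm_sum (bigD1 1%g) //= blockprod_unit eqxx big1 ?addr0 // => s s1.
by rewrite blockprod_unit (negPf s1).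
Qed.

Lemma transitive_sum_unit w m : transitive_sum w unit_weight m.+1 = m`!%:R * w m.+1.
Proof.
have wJ (g h : 'S_m.+1) : blockprod w (porbits (g ^ h)%g) = blockprod w (porbits g).
  exact: blockprodJ.
have := sum_cycles wJ; rewrite blockprod_cycle ?card_porbits_gamma // card_ord => <-.
rewrite [RHS]big_mkcond; apply: eq_bigr => s _.
have c1 : transitive_pair s 1%g = (#|porbits s| == 1%N).
  apply/idP/idP => [/(genus_inequality ord0)|/eqP s1].
    by rewrite porbits1 mul1g card_ord; have := porbits_gt0 s; card_lia.
  apply/(transitive_pairP _ _ ord0) => A sA _ xA; apply/setP => y; rewrite inE.
  by rewrite (stable_porbit sA (porbits1P s1 y ord0)).
rewrite big_mkcond (bigD1 1%g) //= big1 ?addr0 => [|u u1]; last first.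
  by rewrite blockprod_unit (negPf u1) mulr0; case: ifP.
by rewrite c1 blockprod_unit eqxx mulr1.
Qed.

(** The exponential formula.  Both sides solve the recursion with the same cumulants: a
    single permutation is transitive when it is a cycle, and there are [k`!] cycles of
    length [k.+1]. *)
Lemma perm_sum_cumulant e w : e 0%N = 1 ->
  (forall k, partition_cumulant e k.+1 = k`!%:R * w k.+1) ->
  forall n, perm_sum w n = e n.
Proof.
move=> e0 cw n; have e0' : perm_sum w 0 = e 0%N by rewrite perm_sum0.
(* the second permutation is constrained to be the identity *)
have H : cumulant_rec n (perm_sum w) (transitive_sum w unit_weight).
  apply: (cumulant_rec_ext _ _ (@cumulant_rec_transitive_sum R w unit_weight n)) => // k _.
  by rewrite perm_sum_unit mulr1.
apply: (cumulant_rec_uniql e0' _ H (@cumulant_rec_partition R e n e0)) => // k _.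
by rewrite transitive_sum_unit cw.
Qed.

End Logrec.

Section FiniteFree.
Variables (R : realType) (d : nat).
Hypothesis d0 : (0 < d)%N.
Implicit Types (p q : {poly R}) (a b : nat -> R).

Let z : R := - d%:R^-1.

Let dR0 : d%:R != 0 :> R. Proof. by rewrite pnatr_eq0 -lt0n. Qed.
Let z0 : z != 0. Proof. by rewrite oppr_eq0 invr_eq0. Qed.

Lemma scale_neq0 n : n`!%:R * z ^+ n != 0.
Proof. by rewrite mulf_neq0 ?expf_neq0 // pnatr_eq0 -lt0n fact_gt0. Qed.

Lemma ecoef0 p : p \is monic -> size p = d.+1 -> ecoef d p 0 = 1.
Proof.
move=> /monicP mp sp; rewrite /ecoef expr0 mul1r subn0 bin0 divr1.
by rewrite -mp lead_coefE sp.
Qed.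

Lemma finite_free_cumulantE p n : finite_free_cumulant d p n.+1 =
  (n`!%:R * z ^+ n)^-1 * partition_cumulant (ecoef d p) n.+1.
Proof.
rewrite /finite_free_cumulant /partition_cumulant /partition_cumulant_on /=.
congr (_ * _); last by apply: eq_bigl => P; rewrite inE.
by rewrite invfM mulrC /z -exprVn invrN invrK.
Qed.

(** The weight of a cycle of length [k], when [a k] is the finite free cumulant. *)
Definition scaled a k := a k * z ^+ k.-1.

Lemma perm_sum_ecoef p n : p \is monic -> size p = d.+1 ->
  perm_sum (scaled (finite_free_cumulant d p)) n = ecoef d p n.
Proof.
move=> mp sp; apply: perm_sum_cumulant => [|k]; first exact: ecoef0.
rewrite /scaled finite_free_cumulantE /= [RHS]mulrC -[RHS]mulrA [_ ^+ _ * _]mulrC.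
by rewrite mulrAC mulVf ?mul1r // scale_neq0.
Qed.

Lemma scale_inj n x y : n`!%:R * z ^+ n * x = n`!%:R * z ^+ n * y -> x = y.
Proof. exact/mulfI/scale_neq0. Qed.

Lemma coef_mul_conv p q k : (k <= d)%N ->
  (mul_conv d p q)`_(d - k) = (-1) ^+ k * 'C(d, k)%:R * ecoef d p k * ecoef d q k.
Proof.
move=> kd; rewrite /mul_conv coef_sum (bigD1 (Ordinal (_ : k < d.+1)%N)) //=.
rewrite coefZ coefXn eqxx mulr1 big1 ?addr0 // => i ik.
rewrite coefZ coefXn; case: eqP => [E|]; last by rewrite mulr0.
case/eqP: ik; apply: val_inj => /=; have := ltn_ord i; move: E kd; lia.
Qed.

Lemma monic_mul_conv p q : p \is monic -> size p = d.+1 -> q \is monic -> size q = d.+1 ->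
  mul_conv d p q \is monic /\ size (mul_conv d p q) = d.+1.
Proof.
move=> mp sp mq sq; have c0 : (mul_conv d p q)`_d = 1.
  by have := coef_mul_conv p q (leq0n d); rewrite subn0 bin0 !ecoef0 // expr0 !mul1r.
have s : size (mul_conv d p q) = d.+1.
  apply/eqP; rewrite eqn_leq; apply/andP; split; last first.
    by rewrite ltnNge; apply/negP => /leq_sizeP/(_ d (leqnn d))/eqP; rewrite c0 oner_eq0.
  apply: (leq_trans (size_sum _ _ _)); apply/bigmax_leqP => i _.
  by rewrite (leq_trans (size_scale_leq _ _)) // size_polyXn ltnS leq_subr.
by split=> //; apply/monicP; rewrite lead_coefE s.
Qed.

Lemma ecoef_mul_conv p q k : (k <= d)%N ->
  ecoef d (mul_conv d p q) k = ecoef d p k * ecoef d q k.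
Proof.
move=> kd; have C0 : 'C(d, k)%:R != 0 :> R by rewrite pnatr_eq0 -lt0n bin_gt0.
have := coef_mul_conv p q kd; move: (ecoef d p k) (ecoef d q k) => u v.
by rewrite /ecoef => ->; rewrite !mulrA -expr2 sqrr_sign mul1r; field.
Qed.

(** Normalised coefficients multiply under the convolution, and each of them is a sum
    over permutations by [perm_sum_ecoef]. *)
Lemma cumulant_mul_conv p q n : (n < d)%N ->
  p \is monic -> size p = d.+1 -> q \is monic -> size q = d.+1 ->
  finite_free_cumulant d (mul_conv d p q) n.+1 =
  pair_series n.+1 z (finite_free_cumulant d p) (finite_free_cumulant d q).
Proof.
move=> nd mp sp mq sq; have [mpq spq] := monic_mul_conv mp sp mq sq.
apply: (@scale_inj n); rewrite -transitive_sum_pair_series finite_free_cumulantE.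
rewrite mulrA mulfV ?scale_neq0 // mul1r.
have H1 := @cumulant_rec_partition R _ d (ecoef0 mpq spq).
have H2 := @cumulant_rec_transitive_sum R (scaled (finite_free_cumulant d p)) (scaled (finite_free_cumulant d q)) d.
apply: (cumulant_rec_uniqr (ecoef0 mpq spq) _ H1 H2 nd) => k kd.
by rewrite !perm_sum_ecoef // ecoef_mul_conv.
Qed.

(** The normalised coefficients [d^_n / d^n], those of a Laguerre polynomial, have all
    finite free cumulants equal to 1. *)
Lemma perm_sum_ffact n : perm_sum (scaled (fun _ => 1)) n = (d ^_ n)%:R * d%:R^-1 ^+ n.
Proof.
have H1 := @cumulant_rec_transitive_sum R (scaled (fun _ => 1)) (@unit_weight R) n.
have H2 := cumulant_rec_scale (d%:R^-1) (@cumulant_rec_ffact R d n).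
have e0 : perm_sum (scaled (fun _ => 1)) 0 * perm_sum (@unit_weight R) 0 = (d ^_ 0%N)%:R * d%:R^-1 ^+ 0.
  by rewrite !perm_sum0 ffactn0 expr0.
have := cumulant_rec_uniql e0 _ H1 H2 (leqnn n); rewrite perm_sum_unit mulr1 => -> // k kn.
rewrite transitive_sum_unit /scaled /z /= mul1r [in LHS]exprNn exprS.
by move: ((-1) ^+ k) (d%:R^-1 ^+ k) (k`!%:R) => u v t; field.
Qed.

Lemma cumulant_rec_poly_moment p : p \is monic -> size p = d.+1 ->
  cumulant_rec d (fun k => (d ^_ k)%:R * ecoef d p k)
    (fun k => (-1) ^+ k.-1 * k.-1`!%:R * (d%:R * poly_moment d p k)).
Proof.
move=> mp sp n nd.
pose s := complex_roots p; have pE := complex_rootsE mp; rewrite -/s in pE.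
have ss : size s = d.
  have := congr1 (fun r : {poly R[i]} => size r) pE.
  by rewrite size_map_poly sp size_prod_XsubC => -[].
have eE k : (k <= d)%N ->
    real_complex R ((d ^_ k)%:R * ecoef d p k) = k`!%:R * elem_sym s k.
  move=> kd; have C0 : 'C(d, k)%:R != 0 :> R by rewrite pnatr_eq0 -lt0n bin_gt0.
  have -> : (d ^_ k)%:R * ecoef d p k = k`!%:R * ((-1) ^+ k * p`_(d - k)).
    by rewrite -bin_ffact natrM /ecoef; field.
  rewrite !rmorphM rmorph_nat rmorphXn rmorphN1; congr (_ * _).
  rewrite -coef_map pE -{1}ss elem_sym_coef ?ss // mulrA -exprD addnn -mul2n exprM sqrrN !expr1n mul1r //.
have inj : injective (real_complex R) by exact: fmorph_inj.
apply: inj; rewrite eE // newton_binomial rmorph_sum /=.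
apply: eq_bigr => k _; have kn : (k <= n)%N by rewrite -ltnS.
rewrite rmorphM /= eE; last by rewrite (leq_trans (leq_subr _ _)) // ltnW.
congr (_ * _); rewrite rmorphM rmorph_nat; congr (_ * _).
rewrite !rmorphM !rmorph_nat rmorphXn rmorphN1 /=; congr (_ * _).
by rewrite poly_momentE // mulrA mulfV ?mul1r // pnatr_eq0 -lt0n.
Qed.

(** By Newton's identities, multiplication by the coefficients of [perm_sum_ffact]
    turns finite free cumulants into moments. *)
Lemma poly_moment_series p n : (n < d)%N -> p \is monic -> size p = d.+1 ->
  poly_moment d p n.+1 = pair_series n.+1 z (finite_free_cumulant d p) (fun _ => 1).
Proof.
move=> nd mp sp; apply: (@scale_inj n); rewrite -transitive_sum_pair_series.
have H1 := cumulant_rec_scale (d%:R^-1) (cumulant_rec_poly_moment mp sp).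
have H2 := @cumulant_rec_transitive_sum R (scaled (finite_free_cumulant d p)) (scaled (fun _ => 1)) d.
rewrite -(cumulant_rec_uniqr _ _ H1 H2 nd) /=.
- rewrite /z [in LHS]exprNn exprS.
  by move: ((-1) ^+ n) (d%:R^-1 ^+ n) (n`!%:R) => u v t; field.
- by rewrite ffactn0 ecoef0 // !mul1r.
by move=> k kd; rewrite perm_sum_ecoef // perm_sum_ffact; ring.
Qed.

End FiniteFree.

From mathcomp Require Import all_classical all_reals all_analysis.
Import numFieldNormedType.Exports.

(** * First order expansions *)

Section Expansions.
Variable R : realType.

(** [x d = x0 + x1 / d + o(1 / d)]. *)
Definition expands (x : nat -> R) (x0 x1 : R) : Prop :=
  (d%:R * (x d - x0) @[d --> \oo] --> (x1 : R))%classic.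

Lemma cvg_invn : ((d%:R)^-1 @[d --> \oo] --> (0 : R))%classic.
Proof.
apply/gtr0_cvgV0; last exact: cvgr_idn.
by near=> d; rewrite ltr0n; near: d; exact: nbhs_infty_gt.
Unshelve. all: by end_near.
Qed.

Lemma expands_near x y x0 x1 : (\forall d \near \oo, x d = y d)%classic ->
  expands x x0 x1 -> expands y x0 x1.
Proof.
move=> xy; apply: cvg_trans; apply: near_eq_cvg.
by near=> d; congr (_ * (_ - _)); near: d.
Unshelve. all: by end_near.
Qed.

Lemma expands_cvg x x0 x1 : expands x x0 x1 -> (x d @[d --> \oo] --> x0)%classic.
Proof.
move=> xx; have H : (x0 + d%:R^-1 * (d%:R * (x d - x0)) @[d --> \oo] --> x0 + 0 * x1)%classic.
  by apply: cvgD; [apply: cvg_cst | apply: cvgM => //; apply: cvg_invn].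
rewrite mul0r addr0 in H; apply: cvg_trans H; apply: near_eq_cvg.
near=> d; have d0 : d%:R != 0 :> R.
  by rewrite pnatr_eq0 -lt0n; near: d; exact: nbhs_infty_gt.
by rewrite mulKf // addrC subrK.
Unshelve. all: by end_near.
Qed.

Lemma expands_cst c : expands (fun _ => c) c 0.
Proof. by rewrite /expands; under eq_fun do rewrite subrr mulr0; apply: cvg_cst. Qed.

Lemma expandsD x y x0 y0 x1 y1 : expands x x0 x1 -> expands y y0 y1 ->
  expands (fun d => x d + y d) (x0 + y0) (x1 + y1).
Proof.
move=> xx yy; rewrite /expands.
have -> : (fun d => d%:R * (x d + y d - (x0 + y0))) =
  (fun d => d%:R * (x d - x0) + d%:R * (y d - y0)) by apply/funext => d; ring.
exact: cvgD.
Qed.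

Lemma expandsM x y x0 y0 x1 y1 : expands x x0 x1 -> expands y y0 y1 ->
  expands (fun d => x d * y d) (x0 * y0) (x1 * y0 + x0 * y1).
Proof.
move=> xx yy; rewrite /expands.
have -> : (fun d => d%:R * (x d * y d - x0 * y0)) =
  (fun d => d%:R * (x d - x0) * y d + x0 * (d%:R * (y d - y0))) by apply/funext => d; ring.
apply: cvgD; first by apply: cvgM => //; apply: expands_cvg yy.
by apply: cvgM => //; apply: cvg_cst.
Qed.

Lemma expandsZ c x x0 x1 : expands x x0 x1 ->
  expands (fun d => c * x d) (c * x0) (c * x1).
Proof. by move=> xx; have := expandsM (expands_cst c) xx; rewrite mul0r add0r. Qed.

Lemma expands_sum (I : Type) (r : seq I) (Q : pred I) (x : I -> nat -> R) (x0 x1 : I -> R) :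
  (forall i, Q i -> expands (x i) (x0 i) (x1 i)) ->
  expands (fun d => \sum_(i <- r | Q i) x i d) (\sum_(i <- r | Q i) x0 i)
    (\sum_(i <- r | Q i) x1 i).
Proof.
move=> xx; elim: r => [|i r IH].
  by under [X in expands X]eq_fun do rewrite big_nil; rewrite !big_nil; apply: expands_cst.
under [X in expands X]eq_fun do rewrite big_cons; rewrite !big_cons.
by case: ifP => // Qi; apply: expandsD => //; apply: xx.
Qed.

(** The quotient of [w] by a sequence tending to 1. *)
Lemma expands_div x c w w0 w1 c1 : expands w w0 w1 -> expands c 1 c1 ->
  (\forall d \near \oo, w d = x d * c d)%classic ->
  expands x w0 (w1 - w0 * c1).
Proof.
move=> ww cc wxc; have c_1 := expands_cvg cc.
have c1_lt : (\forall d \near \oo, `|1 - c d| < 1)%classic.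
  by move/cvgrPdist_lt: c_1; apply; exact: ltr01.
have H : ((d%:R * (w d - w0) - w0 * (d%:R * (c d - 1))) * (c d)^-1
    @[d --> \oo] --> (w1 - w0 * c1) * 1^-1)%classic.
  apply: cvgM; last by apply: cvgV => //; apply: oner_neq0.
  by apply: cvgB => //; apply: cvgM => //; apply: cvg_cst.
rewrite invr1 mulr1 in H; apply: cvg_trans H; apply: near_eq_cvg.
near=> d; have cd0 : c d != 0.
  have : `|1 - c d| < 1 by near: d.
  by apply: contraTneq => ->; rewrite subr0 normr1 ltxx.
have -> : w d = x d * c d by near: d.
by field.
Unshelve. all: by end_near.
Qed.

Lemma expands_inv_pow k : expands (fun d => (- d%:R^-1) ^+ k) (k == 0)%:R (- (k == 1%N)%:R).
Proof.
have e1 : expands (fun d => - d%:R^-1) 0 (- 1).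
  have H : ((- 1 : R) @[_ --> \oo] --> (- 1 : R))%classic by apply: cvg_cst.
  apply: cvg_trans H; apply: near_eq_cvg; near=> d; have d0 : d%:R != 0 :> R.
    by rewrite pnatr_eq0 -lt0n; near: d; exact: nbhs_infty_gt.
  by rewrite subr0 mulrN mulfV.
elim: k => [|k IH].
  by under [X in expands X]eq_fun do rewrite expr0; rewrite oppr0; apply: expands_cst.
under [X in expands X]eq_fun do rewrite exprS.
have := expandsM e1 IH; rewrite !mul0r addr0 eqSS mulN1r.
by case: k {IH} => [|k].
Unshelve. all: by end_near.
Qed.

(** Leibniz rule: [blockderiv] collects the first order terms of a product. *)
Lemma expands_blockprod (T : finType) (P : {set {set T}}) (a : nat -> nat -> R) a0 a1 :
  (forall V, V \in P -> expands (fun d => a d #|V|) (a0 #|V|) (a1 #|V|)) ->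
  expands (fun d => blockprod (a d) P) (blockprod a0 P) (blockderiv a1 a0 P).
Proof.
have [k] := ubnP #|P|; elim: k P => // k IH P Pk aP.
have [->|[V VP]] := finset.set_0Vmem P.
  rewrite /blockderiv /blockprod !big_set0.
  by under [X in expands X]eq_fun do rewrite big_set0; apply: expands_cst.
under [X in expands X]eq_fun do rewrite (blockprodD1 _ VP).
rewrite (blockprodD1 _ VP) /blockderiv (big_setD1 V) //=.
have -> : \sum_(W in (P :\ V)%SET) a1 #|W| * blockprod a0 (P :\ W)%SET =
    a0 #|V| * blockderiv a1 a0 (P :\ V)%SET.
  rewrite mulr_sumr; apply: eq_bigr => W; rewrite in_setD1 => /andP[WV WP].
  rewrite (@blockprodD1 _ _ _ (P :\ W)%SET V) ?in_setD1 ?VP ?andbT 1?eq_sym //.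
  rewrite mulrCA; congr (_ * (_ * blockprod _ _)).
  by apply/setP => X; rewrite !in_setD1 andbCA.
apply: expandsM; first exact: aP.
apply: IH => [|W]; first by move: Pk; rewrite (cardsD1 V) VP add1n ltnS.
by rewrite in_setD1 => /andP[_]; apply: aP.
Qed.

End Expansions.

(** * Infinitesimal distribution of the convolution *)

Section Convergence.
Variable R : realType.

Definition expands_upto n (a : nat -> nat -> R) (a0 a1 : nat -> R) :=
  forall k, (1 <= k <= n)%N -> expands (fun d => a d k) (a0 k) (a1 k).

Lemma expands_cycle_product n (s : 'S_n) a a0 a1 : expands_upto n a a0 a1 ->
  expands (fun d => blockprod (a d) (porbits s)) (blockprod a0 (porbits s))
    (blockderiv a1 a0 (porbits s)).
Proof.
move=> aE; apply: expands_blockprod => _ /imsetP[x _ ->]; apply: aE.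
by rewrite lt0n card_porbit_neq0 -[X in (_ <= X)%N]card_ord max_card.
Qed.

Definition first_order_coef n (a0 a1 b0 b1 : nat -> R) : R :=
  \sum_(P in NC n) (blockderiv a1 a0 P * blockprod b0 (Kr P)
                    + blockprod a0 P * blockderiv b1 b0 (Kr P))
  - n%:R / 2 * \sum_(1 <= t < n) \sum_(sigma in SNC t (n - t))
      blockprod a0 (porbits sigma) * blockprod b0 (porbits (Kr2 sigma))
      / (t%:R * (n - t)%:R).

(** The power of [z = - 1 / d] attached to a transitive pair is 0 if the pair is planar,
    1 if it is annular, and at least 2 otherwise; this sign of [z] is the one in front
    of the annular sum. *)
Lemma expands_pair_series m a b a0 a1 b0 b1 :
  expands_upto m.+1 a a0 a1 -> expands_upto m.+1 b b0 b1 ->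
  expands (fun d => pair_series m.+1 (- d%:R^-1) (a d) (b d))
    (\sum_(P in NC m.+1) blockprod a0 P * blockprod b0 (Kr P))
    (first_order_coef m.+1 a0 a1 b0 b1).
Proof.
move=> aE bE.
pose F0 (P Q : {set {set 'I_m.+1}}) := blockprod a0 P * blockprod b0 Q.
pose F1 (P Q : {set {set 'I_m.+1}}) :=
  blockderiv a1 a0 P * blockprod b0 Q + blockprod a0 P * blockderiv b1 b0 Q.
have F0I : imset_invariant F0.
  by move=> h P Q; rewrite /F0 !blockprod_imset //; apply: perm_inj.
have F1I : imset_invariant F1.
  by move=> h P Q; rewrite /F1 !blockprod_imset ?blockderiv_imset //; apply: perm_inj.
pose e (s u : 'S_m.+1) := (m.+2 - (#|porbits s| + #|porbits u|))%N.
have H : expands (fun d => pair_series m.+1 (- d%:R^-1) (a d) (b d))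
   (m`!%:R^-1 * \sum_(s : 'S_m.+1) \sum_(u : 'S_m.+1 | transitive_pair s u)
      (e s u == 0%N)%:R * F0 (porbits s) (porbits u))
   (m`!%:R^-1 * \sum_(s : 'S_m.+1) \sum_(u : 'S_m.+1 | transitive_pair s u)
      (- (e s u == 1%N)%:R * F0 (porbits s) (porbits u) +
       (e s u == 0%N)%:R * F1 (porbits s) (porbits u))).
  apply: expandsZ; apply: expands_sum => s _; apply: expands_sum => u _.
  apply: expandsM; first exact: expands_inv_pow.
  by apply: expandsM; apply: expands_cycle_product.
have planar (F : {set {set 'I_m.+1}} -> {set {set 'I_m.+1}} -> R) : imset_invariant F ->
    m`!%:R^-1 * \sum_(s : 'S_m.+1) \sum_(u : 'S_m.+1 | transitive_pair s u)
      (e s u == 0%N)%:R * F (porbits s) (porbits u) = \sum_(P in NC m.+1) F P (Kr P).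
  move=> FI; rewrite -sum_transitive_planar //; congr (_ * _); apply: eq_bigr => s _.
  rewrite [RHS]big_mkcondr; apply: eq_bigr => u cu.
  have -> : (e s u == 0%N) = (#|porbits s| + #|porbits u| == m.+2)%N.
    have := genus_inequality ord0 cu; have := porbits_gt0 (u * s)%g; rewrite card_ord /e; card_lia.
  by case: ifP; rewrite ?mul1r ?mul0r.
have annular1 : m`!%:R^-1 * \sum_(s : 'S_m.+1) \sum_(u : 'S_m.+1 | transitive_pair s u)
      (e s u == 1%N)%:R * F0 (porbits s) (porbits u) =
    m.+1%:R / 2 * \sum_(1 <= t < m.+1) annular a0 b0 t (m.+1 - t) / (t%:R * (m.+1 - t)%:R).
  rewrite -sum_transitive_annular; congr (_ * _); apply: eq_bigr => s _.
  rewrite [RHS]big_mkcondr; apply: eq_bigr => u cu.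
  have -> : (e s u == 1%N) = (#|porbits s| + #|porbits u| == m.+1)%N.
    by rewrite /e; card_lia.
  by case: ifP; rewrite ?mul1r ?mul0r.
rewrite planar // in H.
suff -> : first_order_coef m.+1 a0 a1 b0 b1 = m`!%:R^-1 * \sum_(s : 'S_m.+1) \sum_(u : 'S_m.+1 | transitive_pair s u)
      (- (e s u == 1%N)%:R * F0 (porbits s) (porbits u) +
       (e s u == 0%N)%:R * F1 (porbits s) (porbits u)) by exact: H.
under [in RHS]eq_bigr do rewrite big_split /=.
rewrite big_split /= mulrDr planar // addrC; congr (_ + _).
under [in RHS]eq_bigr do under eq_bigr do rewrite mulNr.
under [in RHS]eq_bigr do rewrite sumrN.
rewrite sumrN mulrN annular1; congr (- (_ * _)).
by apply: eq_bigr => t _; rewrite /annular mulr_suml.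
Qed.

(** Together with [truncated] this splits off a weight its value at [n], which only
    the one-block partition of a set of size [n] involves. *)
Definition top_weight n (k : nat) : R := (k == n)%:R.
Definition truncated n (a : nat -> R) k : R := if (k < n)%N then a k else 0.

Lemma blockprod_top m (P : {set {set 'I_m.+1}}) (a : nat -> R) :
  finset.partition P [set: 'I_m.+1]%SET ->
  blockprod a P = a m.+1 * blockprod (top_weight m.+1) P + blockprod (truncated m.+1 a) P.
Proof.
move=> PT; have [V0 V0P] : exists V, V \in P.
  by exists (finset.pblock P ord0); rewrite pblock_mem // (cover_partition PT).
have [/existsP[V /andP[VP /eqP Vm]]|/existsPn noV] := boolP [exists V, (V \in P) && (#|V| == m.+1)].
  have VT : V = [set: 'I_m.+1]%SET.
    by apply/eqP; rewrite eqEcard finset.subsetT cardsT card_ord Vm leqnn.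
  have -> : P = [set V]%SET.
    apply/eqP; rewrite finset.eqEsubset finset.sub1set VP andbT; apply/fintype.subsetP => W WP; rewrite inE.
    have /set0Pn[i iW] := partition_neq0 PT WP.
    have tP := partition_trivIset PT.
    by rewrite -(def_pblock tP WP iW) (@def_pblock _ _ _ i tP VP) // VT inE.
  rewrite !blockprod1 Vm /top_weight /truncated eqxx mulr1.
  by rewrite ltnn addr0.
have Vn V : V \in P -> (#|V| < m.+1)%N.
  move=> VP; rewrite ltn_neqAle; have := noV V; rewrite VP /= => ->.
  by rewrite -[X in (_ <= X)%N]card_ord max_card.
rewrite [blockprod (top_weight _) _](blockprodD1 _ V0P) /top_weight (ltn_eqF (Vn _ V0P)).
rewrite mul0r mulr0 add0r; apply: eq_bigr => V VP.
by rewrite /truncated Vn.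
Qed.

Lemma NC_partition n P : P \in NC n -> finset.partition P [set: 'I_n]%SET.
Proof. by rewrite inE inE => /andP[]. Qed.

Lemma NC_top m : [set [set: 'I_m.+1]]%SET \in NC m.+1.
Proof.
rewrite !inE; apply/andP; split.
  apply/and3P; split; first by rewrite cover1.
    exact: finset.trivIset1.
  by rewrite inE eq_sym -card_gt0 cardsT card_ord.
by do 2![apply/forall_inP => ? /set1P->]; rewrite eqxx.
Qed.

Lemma blockprod_one (T : finType) (P : {set {set T}}) : blockprod (fun _ => 1 : R) P = 1.
Proof. by rewrite /blockprod big1. Qed.

Lemma blockderiv_zero (T : finType) u (P : {set {set T}}) : blockderiv (fun _ => 0 : R) u P = 0.
Proof. by rewrite /blockderiv big1 // => V _; rewrite mul0r. Qed.

Lemma sum_NC_top m : \sum_(P in NC m.+1) blockprod (top_weight m.+1) P = 1.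
Proof.
rewrite (bigD1 [set [set: 'I_m.+1]]%SET) ?NC_top //= blockprod1 cardsT card_ord /top_weight eqxx.
rewrite big1 ?addr0 // => P /andP[PNC PT].
have /set0Pn[V VP] : P != finset.set0.
  apply/eqP => P0; have := cover_partition (NC_partition PNC).
  by rewrite P0 /finset.cover big_set0 => /setP/(_ ord0); rewrite !inE.
have /andP[_ Vm] := NC_block_size PNC PT VP.
by rewrite (blockprodD1 _ VP) (ltn_eqF Vm) mul0r.
Qed.

Lemma pair_series_top m (z : R) a : pair_series m.+1 z a (fun _ => 1) =
  a m.+1 * pair_series m.+1 z (top_weight m.+1) (fun _ => 1) +
  pair_series m.+1 z (truncated m.+1 a) (fun _ => 1).
Proof.
rewrite /pair_series mulrCA -mulrDr; congr (_ * _).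
rewrite mulr_sumr -big_split; apply: eq_bigr => s _ /=.
rewrite mulr_sumr -big_split; apply: eq_bigr => u _ /=.
by rewrite (blockprod_top a (partition_porbits s)) mulrDl mulrDr -[X in z ^+ _ * X + _]mulrA mulrCA.
Qed.

Lemma expands_one n : expands_upto n (fun _ _ => 1) (fun _ => 1) (fun _ => 0).
Proof. by move=> k _; apply: expands_cst. Qed.

Implicit Types mu : probability (measurableTypeR R) R.

Lemma free_cumulant_top mu m : dist_moment mu m.+1 = free_cumulant mu m.+1 +
  \sum_(P in NC m.+1) blockprod (truncated m.+1 (free_cumulant mu)) P.
Proof.
rewrite free_cumulantE //.
rewrite (eq_bigr _ (fun P PNC => blockprod_top (free_cumulant mu) (NC_partition PNC))).
by rewrite big_split /= -mulr_sumr sum_NC_top mulr1.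
Qed.

(** Solve the moment formula [poly_moment_series] for the top cumulant, by induction:
    the top cumulant enters linearly, with a coefficient that tends to 1 by
    [sum_NC_top].  At order 0 this is the recursion defining the free cumulants. *)
Lemma finite_free_cumulant_expands (p : nat -> {poly R}) mu (m1 : nat -> R) :
  (forall d, (1 <= d)%N -> p d \is monic /\ size (p d) = d.+1) ->
  has_infinitesimal_moments p mu m1 ->
  forall n, (1 <= n)%N -> exists c,
    expands (fun d => finite_free_cumulant d (p d) n) (free_cumulant mu n) c.
Proof.
move=> pmon pm; elim/ltn_ind => -[//|m] IH _.
pose ka d k := finite_free_cumulant d (p d) k.
pose trc := truncated m.+1.
have [c1 c1E] : exists c1 : nat -> R,
    expands_upto m.+1 (fun d => trc (ka d)) (trc (free_cumulant mu)) c1.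
  have ex k : exists c, (1 <= k <= m.+1)%N ->
      expands (fun d => trc (ka d) k) (trc (free_cumulant mu) k) c.
    rewrite /trc /truncated; case: (ltnP k m.+1) => km; last by exists 0 => _; apply: expands_cst.
    case: k km => [|k] km; first by exists 0.
    by have [c cE] := IH _ km isT; exists c.
  by exists (fun k => projT1 (cid (ex k))) => k kn; apply: (projT2 (cid (ex k))).
have topE : expands_upto m.+1 (fun _ => top_weight m.+1) (top_weight m.+1) (fun _ => 0).
  by move=> k _; apply: expands_cst.
have rest := expands_pair_series c1E (@expands_one m.+1).
have coef := expands_pair_series topE (@expands_one m.+1).
have mom : expands (fun d => poly_moment d (p d) m.+1) (dist_moment mu m.+1) (m1 m.+1).
  exact: pm.
have one0 (a : nat -> R) : \sum_(P in NC m.+1) blockprod a P * blockprod (fun _ => 1) (Kr P) =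
    \sum_(P in NC m.+1) blockprod a P.
  by apply: eq_bigr => P _; rewrite blockprod_one mulr1.
rewrite one0 in rest; rewrite one0 sum_NC_top in coef.
have numer := expandsD mom (expandsZ (c := -1) rest).
eexists; apply: (expands_div (w0 := free_cumulant mu m.+1) _ coef).
  have -> : free_cumulant mu m.+1 = dist_moment mu m.+1 +
      -1 * \sum_(P in NC m.+1) blockprod (trc (free_cumulant mu)) P.
    by rewrite free_cumulant_top mulN1r addrK.
  exact: numer.
near=> d; have md : (m < d)%N by near: d; exact: nbhs_infty_gt.
have d0 : (0 < d)%N by apply: leq_trans md.
have [mp sp] := pmon _ d0.
rewrite (poly_moment_series d0 md mp sp) pair_series_top mulN1r; exact: addrK.
Unshelve. all: by end_near.
Qed.

Lemma expands_fluctuation (p : nat -> {poly R}) mu n c :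
  expands (fun d => finite_free_cumulant d (p d) n) (free_cumulant mu n) c ->
  is_cumulant_fluctuation p mu n c.
Proof.
move=> H; apply/eqoP => e e0.
have {}H : (\forall d \near \oo, `|c - d%:R * (finite_free_cumulant d (p d) n - free_cumulant mu n)| < e)%classic.
  by move/cvgrPdist_lt: H; apply.
near=> d; have d0 : 0 < d%:R :> R by rewrite ltr0n; near: d; exact: nbhs_infty_gt.
rewrite (gtr0_norm (_ : 0 < d%:R^-1)) ?invr_gt0 // ler_pdivlMr //.
rewrite -[X in _ * X](gtr0_norm d0) -normrM.
apply: ltW; rewrite (_ : _ * d%:R = - (c - d%:R * (finite_free_cumulant d (p d) n - free_cumulant mu n))).
  by rewrite normrN; near: d.
by field; rewrite gt_eqF.
Unshelve. all: by end_near.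
Qed.

End Convergence.

Theorem theorem3p5 (R : realType)
  (p q : nat -> {poly R})
  (mu nu rho : probability (measurableTypeR R) R)
  (mu' nu' : {scalar {poly R}})
  (hp : forall d : nat, (1 <= d)%N -> monic_real_rooted d (p d))
  (hq : forall d : nat, (1 <= d)%N -> monic_real_rooted d (q d))
  (mu_det : moment_determined mu)
  (nu_det : moment_determined nu)
  (hmu : has_infinitesimal_distribution p mu mu')
  (hnu : has_infinitesimal_distribution q nu nu')
  (nu_supp : supported_on_nonneg nu)
  (hrho : is_free_mul_conv mu nu rho) :
  let pq := seq_mul_conv p q in
  let r := @free_cumulant R in
  let rhat := @cumulant_fluctuation R in
  [/\ forall n : nat, (1 <= n)%N ->
        is_cumulant_fluctuation pq rho n (rhat pq rho n),
      forall n : nat, (1 <= n)%N ->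
        rhat pq rho n =
        \sum_(P in NC n)
          (blockderiv (rhat p mu) (r mu) P * blockprod (r nu) (Kr P)
           + blockprod (r mu) P * blockderiv (rhat q nu) (r nu) (Kr P))
        - n%:R / 2 *
          \sum_(1 <= t < n) \sum_(sigma in SNC t (n - t))
            blockprod (r mu) (porbits sigma)
            * blockprod (r nu) (porbits (Kr2 sigma)) / (t%:R * (n - t)%:R)
    & has_infinitesimal_moments pq rho (fun n =>
        \sum_(P in NC n) blockderiv (rhat pq rho) (r rho) P
        - n%:R / 2 *
          \sum_(1 <= s < n) \sum_(sigma in SNC s (n - s))
            blockprod (r rho) (porbits sigma) / (s%:R * (n - s)%:R))].
Proof.
move=> pq r rhat.
have [_ _ _ hmu1] := hmu; have [_ _ _ hnu1] := hnu.
have pmon d : (1 <= d)%N -> p d \is monic /\ size (p d) = d.+1 by move/hp => [].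
have qmon d : (1 <= d)%N -> q d \is monic /\ size (q d) = d.+1 by move/hq => [].
have fluct (s : nat -> {poly R}) m n c :
    expands (fun d => finite_free_cumulant d (s d) n) (r m n) c -> rhat s m n = c.
  by move/expands_fluctuation; apply: cumulant_fluctuationE.
have pE n : expands_upto n (fun d => finite_free_cumulant d (p d)) (r mu) (rhat p mu).
  move=> k /andP[k0 _]; have [c cE] := finite_free_cumulant_expands pmon hmu1 k0.
  by rewrite (fluct _ _ _ _ cE).
have qE n : expands_upto n (fun d => finite_free_cumulant d (q d)) (r nu) (rhat q nu).
  move=> k /andP[k0 _]; have [c cE] := finite_free_cumulant_expands qmon hnu1 k0.
  by rewrite (fluct _ _ _ _ cE).
have pqE n : (1 <= n)%N -> expands (fun d => finite_free_cumulant d (pq d) n) (r rho n)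
    (first_order_coef n (r mu) (rhat p mu) (r nu) (rhat q nu)).
  case: n => // m _; have [_ hr] := hrho; rewrite /r hr // -/r.
  apply: expands_near (expands_pair_series (pE m.+1) (qE m.+1)); near=> d.
  have md : (m < d)%N by near: d; exact: nbhs_infty_gt.
  have d0 : (0 < d)%N by apply: leq_trans md.
  have [mp sp] := pmon _ d0; have [mq sq] := qmon _ d0.
  by rewrite (cumulant_mul_conv d0 md mp sp mq sq).
have pqE' n : expands_upto n (fun d => finite_free_cumulant d (pq d)) (r rho) (rhat pq rho).
  by move=> k /andP[k0 _]; have cE := pqE _ k0; rewrite (fluct _ _ _ _ cE).
split.
- by move=> n n1; apply: expands_fluctuation; apply: (pqE' n); rewrite n1 leqnn.
- by move=> n n1; apply: fluct; apply: pqE.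
case=> [//|m] _.
have := expands_pair_series (pqE' m.+1) (@expands_one R m.+1).
have -> : \sum_(P in NC m.+1) blockprod (r rho) P * blockprod (fun _ => 1) (Kr P) = dist_moment rho m.+1.
  rewrite free_cumulantE //; apply: eq_bigr => P _; by rewrite blockprod_one mulr1.
have -> : first_order_coef m.+1 (r rho) (rhat pq rho) (fun _ => 1) (fun _ => 0) =
   \sum_(P in NC m.+1) blockderiv (rhat pq rho) (r rho) P
        - m.+1%:R / 2 *
          \sum_(1 <= s < m.+1) \sum_(sigma in SNC s (m.+1 - s))
            blockprod (r rho) (porbits sigma) / (s%:R * (m.+1 - s)%:R).
  rewrite /first_order_coef; congr (_ - _ * _).
    by apply: eq_bigr => P _; rewrite blockderiv_zero mulr0 addr0 blockprod_one mulr1.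
  by apply: eq_bigr => t _; apply: eq_bigr => sigma _; rewrite blockprod_one mulr1.
apply: expands_near; near=> d.
have md : (m < d)%N by near: d; exact: nbhs_infty_gt.
have d0 : (0 < d)%N by apply: leq_trans md.
have [mp sp] := pmon _ d0; have [mq sq] := qmon _ d0.
have [mpq spq] := monic_mul_conv d0 mp sp mq sq.
by rewrite (poly_moment_series d0 md mpq spq).
Unshelve. all: by end_near.
Qed.
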